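(* Let $A$ be a representation-finite artin algebra and $B$ the Auslander algebra of $A$. Then $B$ is a strongly quasi-hereditary algebra if and only if $A$ is a Nakayama algebra.
   Context: $A$ is representation-finite if it has only finitely many isomorphism classes of indecomposable finitely generated right modules; its Auslander algebra is $\mathrm{End}_A(M)$, where $M$ is the direct sum of one representative of each such class. $A$ is a Nakayama algebra if and only if every indecomposable finitely generated $A$-module is uniserial. For an artin algebra $B$ with Jacobson radical $J(B)$: a two-sided ideal $H$ is heredity if $H^2=H$, $H$ is projective as a right $B$-module, and $HJ(B)H=0$. A chain of idempotent ideals $B=H_0>H_1>\cdots>H_n=0$ is a heredity chain if $H_i/H_{i+1}$ is a heredity ideal of $B/H_{i+1}$ for $0\le i\le n-1$. It is a right-strongly (resp. left-strongly) heredity chain if for every $0\le i\le n-1$: (a) $H_i$ is projective as a right (resp. left) $B$-module; (b) $(H_i/H_{i+1})\,J(B/H_{i+1})\,(H_i/H_{i+1})=0$. $B$ is strongly quasi-hereditary if it has a heredity chain which is both a right-strongly heredity chain and a left-strongly heredity chain. *)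

(* Defs.v *)
From HB Require Import structures.
From mathcomp Require Import all_boot all_algebra.
From mathcomp Require Import boolp.

Set Implicit Arguments.
Unset Strict Implicit.
Unset Printing Implicit Defensive.

Import GRing.Theory.
Local Open Scope ring_scope.
Local Open Scope quotient_scope.

(* Rings are unital and may be zero. A right R-module is a left module over   *)
(* the converse ring R^c, with v . a written a *: v; in particular R^c^o is R *)
(* as a right module over itself, and its submodules are the right ideals.    *)
Notation rmodType R := (lmodType R^c).

Section Modules.
Variable R : pzRingType.
Implicit Types M N P : lmodType R.

Definition isomorphic M N : Prop := exists f : {linear M -> N}, bijective f.

Definition finitely_generated M : Prop :=
  exists (n : nat) (v : 'I_n -> M),
    forall x : M, exists a : 'I_n -> R, x = \sum_i a i *: v i.

Definition indecomposable M : Prop :=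
  (exists x : M, x != 0) /\
  forall S T : submodClosed M,
    (forall x, exists s t, [/\ s \in S, t \in T & x = s + t]) ->
    (forall x, x \in S -> x \in T -> x = 0) ->
    (forall x, x \in S -> x = 0) \/ (forall x, x \in T -> x = 0).

Definition uniserial M : Prop :=
  forall S T : submodClosed M, {subset S <= T} \/ {subset T <= S}.

Definition projective P : Prop :=
  forall (M N : lmodType R) (p : {linear M -> N}) (f : {linear P -> N}),
    (forall y, exists x, p x = y) ->
    exists g : {linear P -> M}, forall x, p (g x) = f x.

End Modules.

Section Submodule.
Variables (R : pzRingType) (M : lmodType R) (S : submodClosed M).

Definition submodule : Type := {x : M | x \in S}.
HB.instance Definition _ := SubChoice.on submodule.
HB.instance Definition _ := [SubChoice_isSubLmodule of submodule by <:].

End Submodule.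

Section DirectSum.
Variables (R : pzRingType) (n : nat) (X : 'I_n -> lmodType R).

Definition dsum : Type := forall i, X i.
HB.instance Definition _ := gen_eqMixin dsum.
HB.instance Definition _ := gen_choiceMixin dsum.

Implicit Types u v w : dsum.

Definition dsum_zero : dsum := fun=> 0.
Definition dsum_opp u : dsum := fun i => - u i.
Definition dsum_add u v : dsum := fun i => u i + v i.
Definition dsum_scale (a : R) u : dsum := fun i => a *: u i.

Fact dsum_addA : associative dsum_add.
Proof. by move=> u v w; apply: functional_extensionality_dep => i; exact: addrA. Qed.
Fact dsum_addC : commutative dsum_add.
Proof. by move=> u v; apply: functional_extensionality_dep => i; exact: addrC. Qed.
Fact dsum_add0 : left_id dsum_zero dsum_add.
Proof. by move=> u; apply: functional_extensionality_dep => i; exact: add0r. Qed.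
Fact dsum_addN : left_inverse dsum_zero dsum_opp dsum_add.
Proof. by move=> u; apply: functional_extensionality_dep => i; exact: addNr. Qed.

HB.instance Definition _ :=
  GRing.isZmodule.Build dsum dsum_addA dsum_addC dsum_add0 dsum_addN.

Fact dsum_scaleA a b u : dsum_scale a (dsum_scale b u) = dsum_scale (a * b) u.
Proof. by apply: functional_extensionality_dep => i; exact: scalerA. Qed.
Fact dsum_scale1 : left_id 1 dsum_scale.
Proof. by move=> u; apply: functional_extensionality_dep => i; exact: scale1r. Qed.
Fact dsum_scaleDr : right_distributive dsum_scale +%R.
Proof. by move=> a u v; apply: functional_extensionality_dep => i; exact: scalerDr. Qed.
Fact dsum_scaleDl u : {morph dsum_scale^~ u : a b / a + b}.
Proof. by move=> a b; apply: functional_extensionality_dep => i; exact: scalerDl. Qed.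

HB.instance Definition _ :=
  GRing.Zmodule_isLmodule.Build R dsum
    dsum_scaleA dsum_scale1 dsum_scaleDr dsum_scaleDl.

End DirectSum.

Section EndomorphismRing.
Variables (R : pzRingType) (M : lmodType R).

(* The product is composition: (f * g) x = f (g x). *)
Definition endo : Type := {linear M -> M}.
HB.instance Definition _ := gen_eqMixin endo.
HB.instance Definition _ := gen_choiceMixin endo.

Implicit Types f g h : endo.

Definition endo_apply f : M -> M := f.

Lemma endoP f g : endo_apply f =1 endo_apply g -> f = g.
Proof.
rewrite /endo_apply.
case: f g => [f [[f1] [f2]]] [g [[g1] [g2]]] /= /funext e; subst g.
by rewrite (Prop_irrelevance f1 g1) (Prop_irrelevance f2 g2).
Qed.

Definition endo_zero : endo := [the {linear M -> M} of \0].
Definition endo_opp f : endo := [the {linear M -> M} of \- (f : {linear M -> M})].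
Definition endo_add f g : endo :=
  [the {linear M -> M} of (f : {linear M -> M}) \+ (g : {linear M -> M})].
Definition endo_one : endo := [the {linear M -> M} of idfun].
Definition endo_mul f g : endo :=
  [the {linear M -> M} of (f : {linear M -> M}) \o (g : {linear M -> M})].

Fact endo_addA : associative endo_add.
Proof. by move=> f g h; apply: endoP => x; exact: addrA. Qed.
Fact endo_addC : commutative endo_add.
Proof. by move=> f g; apply: endoP => x; exact: addrC. Qed.
Fact endo_add0 : left_id endo_zero endo_add.
Proof. by move=> f; apply: endoP => x; exact: add0r. Qed.
Fact endo_addN : left_inverse endo_zero endo_opp endo_add.
Proof. by move=> f; apply: endoP => x; exact: addNr. Qed.

HB.instance Definition _ :=
  GRing.isZmodule.Build endo endo_addA endo_addC endo_add0 endo_addN.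

Fact endo_mulA : associative endo_mul.
Proof. by move=> f g h; apply: endoP. Qed.
Fact endo_mul1l : left_id endo_one endo_mul.
Proof. by move=> f; apply: endoP. Qed.
Fact endo_mul1r : right_id endo_one endo_mul.
Proof. by move=> f; apply: endoP. Qed.
Fact endo_mulDl : left_distributive endo_mul +%R.
Proof. by move=> f g h; apply: endoP. Qed.
Fact endo_mulDr : right_distributive endo_mul +%R.
Proof. by move=> f g h; apply: endoP => x; exact: (linearD (f : {linear M -> M})). Qed.

HB.instance Definition _ :=
  GRing.Zmodule_isPzRing.Build endo
    endo_mulA endo_mul1l endo_mul1r endo_mulDl endo_mulDr.

End EndomorphismRing.

Record ideal (R : pzRingType) := Ideal {
  ideal_pred :> {pred R};
  ideal0 : 0 \in ideal_pred;
  idealD : {in ideal_pred &, forall x y, x + y \in ideal_pred};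
  idealMl : forall a, {in ideal_pred, forall x, a * x \in ideal_pred};
  idealMr : forall a, {in ideal_pred, forall x, x * a \in ideal_pred}
}.

Section IdealModules.
Variables (R : pzRingType) (I : ideal R).

Fact ideal_zmod_closed : zmod_closed (ideal_pred I).
Proof.
split=> [|x y xI yI]; first exact: ideal0.
by apply: idealD => //; rewrite -mulN1r; apply: idealMl.
Qed.
HB.instance Definition _ :=
  GRing.isZmodClosed.Build R (ideal_pred I) ideal_zmod_closed.

Definition left_ideal_pred : {pred R^o} := ideal_pred I.
Fact left_ideal_closed : submod_closed left_ideal_pred.
Proof.
split=> [|a x y xI yI]; first exact: ideal0.
by apply: (@idealD R I) => //; apply: (@idealMl R I).
Qed.
HB.instance Definition _ :=
  GRing.isSubmodClosed.Build R R^o left_ideal_pred left_ideal_closed.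

Definition right_ideal_pred : {pred R^c^o} := ideal_pred I.
Fact right_ideal_closed : submod_closed right_ideal_pred.
Proof.
split=> [|a x y xI yI]; first exact: ideal0.
by apply: (@idealD R I) => //; apply: (@idealMr R I).
Qed.
HB.instance Definition _ :=
  GRing.isSubmodClosed.Build R^c R^c^o right_ideal_pred right_ideal_closed.

Definition left_module : lmodType R := submodule left_ideal_pred.
Definition right_module : rmodType R := submodule right_ideal_pred.

End IdealModules.

Section QuotientRing.
Variables (R : pzRingType) (I : ideal R).

Definition quotient_ring : Type := Quotient.quot (ideal_pred I).
HB.instance Definition _ := GRing.Zmodule.on quotient_ring.

Definition quotient_proj (x : R) : quotient_ring :=
  \pi_(Quotient.quot (ideal_pred I)) x.
Definition quotient_repr (x : quotient_ring) : R :=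
  repr (x : Quotient.quot (ideal_pred I)).

Lemma quotient_projP x y :
  reflect (quotient_proj x = quotient_proj y) (x - y \in I).
Proof. by rewrite Quotient.idealrBE; apply: eqP. Qed.

Lemma quotient_reprK : cancel quotient_repr quotient_proj.
Proof. exact: reprK. Qed.

Definition quotient_one : quotient_ring := quotient_proj 1.
Definition quotient_mul (x y : quotient_ring) : quotient_ring :=
  quotient_proj (quotient_repr x * quotient_repr y).

Lemma quotient_projD x y :
  quotient_proj (x + y) = quotient_proj x + quotient_proj y.
Proof. exact: Quotient.pi_add. Qed.

Lemma quotient_projM x y :
  quotient_proj (x * y) = quotient_mul (quotient_proj x) (quotient_proj y).
Proof.
apply/quotient_projP.
set x' := quotient_repr _; set y' := quotient_repr _.
have xI : x - x' \in I by apply/quotient_projP; rewrite quotient_reprK.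
have yI : y - y' \in I by apply/quotient_projP; rewrite quotient_reprK.
have -> : x * y - x' * y' = (x - x') * y + x' * (y - y').
  by rewrite mulrBl mulrBr addrA subrK.
by apply: idealD; [apply: idealMr | apply: idealMl].
Qed.

Lemma quotient_projS (x : quotient_ring) : exists y, x = quotient_proj y.
Proof. by exists (quotient_repr x); rewrite quotient_reprK. Qed.

Fact quotient_mulA : associative quotient_mul.
Proof.
move=> x y z; have [x' ->] := quotient_projS x.
have [y' ->] := quotient_projS y; have [z' ->] := quotient_projS z.
by rewrite -!quotient_projM mulrA.
Qed.
Fact quotient_mul1l : left_id quotient_one quotient_mul.
Proof.
by move=> x; have [x' ->] := quotient_projS x; rewrite -quotient_projM mul1r.
Qed.
Fact quotient_mul1r : right_id quotient_one quotient_mul.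
Proof.
by move=> x; have [x' ->] := quotient_projS x; rewrite -quotient_projM mulr1.
Qed.
Fact quotient_mulDl : left_distributive quotient_mul +%R.
Proof.
move=> x y z; have [x' ->] := quotient_projS x.
have [y' ->] := quotient_projS y; have [z' ->] := quotient_projS z.
by rewrite -quotient_projD -!quotient_projM -quotient_projD mulrDl.
Qed.
Fact quotient_mulDr : right_distributive quotient_mul +%R.
Proof.
move=> x y z; have [x' ->] := quotient_projS x.
have [y' ->] := quotient_projS y; have [z' ->] := quotient_projS z.
by rewrite -quotient_projD -!quotient_projM -quotient_projD mulrDr.
Qed.

HB.instance Definition _ :=
  GRing.Zmodule_isPzRing.Build quotient_ring
    quotient_mulA quotient_mul1l quotient_mul1r quotient_mulDl quotient_mulDr.

Variable H : ideal R.

Definition quotient_ideal_pred : {pred quotient_ring} :=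
  fun y => `[< exists2 x, x \in H & y = quotient_proj x >].

Fact quotient_ideal0 : 0 \in quotient_ideal_pred.
Proof. by apply/asboolP; exists 0; [exact: ideal0 | rewrite /quotient_proj raddf0]. Qed.
Fact quotient_idealD :
  {in quotient_ideal_pred &, forall x y, x + y \in quotient_ideal_pred}.
Proof.
move=> x y /asboolP[x' x'H ->] /asboolP[y' y'H ->]; apply/asboolP.
by exists (x' + y'); [exact: idealD | rewrite quotient_projD].
Qed.
Fact quotient_idealMl a :
  {in quotient_ideal_pred, forall x, a * x \in quotient_ideal_pred}.
Proof.
move=> x /asboolP[x' x'H ->]; have [a' ->] := quotient_projS a; apply/asboolP.
by exists (a' * x'); [exact: idealMl | rewrite quotient_projM].
Qed.
Fact quotient_idealMr a :
  {in quotient_ideal_pred, forall x, x * a \in quotient_ideal_pred}.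
Proof.
move=> x /asboolP[x' x'H ->]; have [a' ->] := quotient_projS a; apply/asboolP.
by exists (x' * a'); [exact: idealMr | rewrite quotient_projM].
Qed.

(* (H + I) / I; this is H / I when I is contained in H. *)
Definition quotient_ideal : ideal quotient_ring :=
  Ideal quotient_ideal0 quotient_idealD quotient_idealMl quotient_idealMr.

End QuotientRing.

Section Heredity.
Variable B : pzRingType.
Implicit Types X Y : {pred B}.

Definition maximal_right_ideal (S : submodClosed B^c^o) : Prop :=
  (1 : B) \notin S /\
  forall T : submodClosed B^c^o,
    {subset S <= T} -> (1 : B) \notin T -> {subset T <= S}.

Definition jacobson_radical : {pred B} :=
  fun x => `[< forall S : submodClosed B^c^o, maximal_right_ideal S -> x \in S >].

Definition ideal_product X Y : {pred B} :=
  fun x => `[< exists (m : nat) (a b : 'I_m -> B),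
    [/\ forall i, a i \in X, forall i, b i \in Y & x = \sum_i a i * b i] >].

Definition idempotent_ideal (H : ideal B) : Prop := ideal_product H H =i H.

Definition radical_sandwich_zero (H : ideal B) : Prop :=
  ideal_product (ideal_product H jacobson_radical) H =i pred1 0.

Definition heredity_ideal (H : ideal B) : Prop :=
  [/\ idempotent_ideal H, projective (right_module H) & radical_sandwich_zero H].

End Heredity.

Section HeredityChains.
Variables (B : pzRingType) (n : nat) (H : nat -> ideal B).

(* B = H 0 > H 1 > ... > H n = 0; the values H i for i > n are irrelevant. *)
Definition idempotent_chain : Prop :=
  [/\ H 0 =i predT, H n =i pred1 0,
      forall i, (i <= n)%N -> idempotent_ideal (H i) &
      forall i, (i < n)%N -> {subset H i.+1 <= H i} /\ ~ {subset H i <= H i.+1}].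

Definition heredity_chain : Prop :=
  idempotent_chain /\
  forall i, (i < n)%N -> heredity_ideal (quotient_ideal (H i.+1) (H i)).

Definition right_strongly_heredity_chain : Prop :=
  idempotent_chain /\
  forall i, (i < n)%N ->
    projective (right_module (H i)) /\
    radical_sandwich_zero (quotient_ideal (H i.+1) (H i)).

Definition left_strongly_heredity_chain : Prop :=
  idempotent_chain /\
  forall i, (i < n)%N ->
    projective (left_module (H i)) /\
    radical_sandwich_zero (quotient_ideal (H i.+1) (H i)).

End HeredityChains.

Definition strongly_quasi_hereditary (B : pzRingType) : Prop :=
  exists (n : nat) (H : nat -> ideal B),
    [/\ heredity_chain n H, right_strongly_heredity_chain n H &
        left_strongly_heredity_chain n H].

Definition artinian (k : comPzRingType) : Prop :=
  forall I : nat -> submodClosed k^o,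
    (forall m, {subset I m.+1 <= I m}) ->
    exists m, forall m', (m <= m')%N -> I m' =i I m.

(* The k-algebra structure on A is a ring morphism from k to the centre of A. *)
Definition artin_algebra (A : pzRingType) : Prop :=
  exists (k : comPzRingType) (s : {rmorphism k -> A}),
    [/\ artinian k,
        forall c x, s c * x = x * s c &
        exists (m : nat) (v : 'I_m -> A),
          forall x, exists c : 'I_m -> k, x = \sum_i s (c i) * v i].

Definition representation_finite (A : pzRingType) : Prop :=
  exists (m : nat) (X : 'I_m -> rmodType A),
    forall M : rmodType A, finitely_generated M -> indecomposable M ->
      exists i, isomorphic M (X i).

Definition indecomposable_representatives
    (A : pzRingType) (m : nat) (X : 'I_m -> rmodType A) : Prop :=
  [/\ forall i, finitely_generated (X i) /\ indecomposable (X i),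
      forall M : rmodType A, finitely_generated M -> indecomposable M ->
        exists i, isomorphic M (X i) &
      forall i j, isomorphic (X i) (X j) -> i = j].

Definition auslander_algebra
    (A : pzRingType) (m : nat) (X : 'I_m -> rmodType A) : pzRingType :=
  endo (dsum X).

Definition nakayama (A : pzRingType) : Prop :=
  forall M : rmodType A,
    finitely_generated M -> indecomposable M -> uniserial M.

(* Main.v *)
(* Every finitely generated module is a direct summand of a power of [M], the *)
(* direct sum of the indecomposables, so [M] is both a generator and a        *)
(* cogenerator. If an ideal [H] of [B = End M] is projective on the right     *)
(* (left), a dual basis shows that [H] consists of all maps with image in     *)
(* [H M] (of all maps killing the common kernel of [H]). Hence the modules    *)
(* whose identity factors through [H] are closed under quotients (submodules).*)
(* Given a strongly heredity chain and an indecomposable [N] that factors     *)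
(* through [H i] but not through [H i.+1], Fitting's lemma makes the          *)
(* inclusion of a proper submodule and the projection onto a proper quotient  *)
(* radical, so both factor through [H i.+1]; therefore [N] is not a sum of    *)
(* two proper submodules and any two nonzero submodules meet. If all          *)
(* indecomposables have these two properties, they are uniserial.             *)
(*                                                                            *)
(* Conversely, order the indecomposables by length and let [I t] be the       *)
(* common annihilator of the first [t] of them. The ideal of maps             *)
(* [M -> soc (I t)] is idempotent and projective on both sides. When the      *)
(* indecomposables are uniserial, those killed by [I t] are exactly the first *)
(* [t], and a non-invertible map between two of them has an indecomposable    *)
(* image of smaller length, which gives the radical condition.                *)

From HB Require Import structures.
From mathcomp Require Import all_boot all_algebra.
From mathcomp Require Import boolp.
From mathcomp Require classical_sets.
Require Import Defs.

Set Implicit Arguments.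
Unset Strict Implicit.
Unset Printing Implicit Defensive.

Import GRing.Theory.
Local Open Scope ring_scope.

(** Write M for the sum of the chosen indecomposables and B for its endomorphism ring. Finite length
    yields Fitting's lemma ([fitting]) and [fg_add]: every finitely generated module is a summand of
    a power of M.

    Necessity. A projective ideal H is as large as its image (on the right) or its common kernel (on
    the left) allows: [right_projective_mem] and [left_projective_mem]. Hence the modules whose
    identity factors through H are closed under quotients ([via_id_surj]) and submodules
    ([via_id_inj]). The radical condition pushes inclusions of proper submodules and projections
    onto proper quotients of an indecomposable N into the next ideal ([inclusion_via],
    [projection_via]). If the identity of N does not follow them, N is hollow (not a sum of two
    proper submodules) and uniform (nonzero submodules meet), by [step_hollow] and [step_uniform].
    When this holds for all indecomposables, [uniserial_criterion] applies.

    Sufficiency. For a set U of indecomposables with common annihilator I, the ideal [annih_ideal]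
    is both Hom(M, K), with K the part of M killed by I, and Hom(Q, M) for a quotient Q of M; since
    K and Q are summands of powers of M, it is projective on both sides and idempotent. If
    indecomposables are uniserial and U is closed under subquotients, I determines U
    ([killed_type]). Removing one indecomposable at a time, longest first, gives the chain: a map
    between members of U factors through its image, which belongs to the smaller set unless the map
    is an automorphism of the removed module, and that case is settled by quasi-regularity
    ([annih_sandwich]). *)

Lemma ex_max_nat (P : nat -> Prop) (b : nat) :
    (exists n, P n) -> (forall n, P n -> (n <= b)%N) ->
  exists2 n, P n & forall i, P i -> (i <= n)%N.
Proof.
move=> exP leb.
have exP' : exists n, `[< P n >] by have [n Pn] := exP; exists n; apply/asboolP.
have leb' n : `[< P n >] -> (n <= b)%N by move=> /asboolP; exact: leb.
case: (ex_maxnP exP' leb') => n /asboolP Pn maxn; exists n => // i Pi.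
by apply: maxn; apply/asboolP.
Qed.

Lemma ex_min_nat (P : nat -> Prop) :
  (exists n, P n) -> exists2 n, P n & forall i, P i -> (n <= i)%N.
Proof.
move=> exP.
have exP' : exists n, `[< P n >] by have [n Pn] := exP; exists n; apply/asboolP.
case: (ex_minnP exP') => n /asboolP Pn minn; exists n => // i Pi.
by apply: minn; apply/asboolP.
Qed.

Section Linear.
Variable R : pzRingType.
Implicit Types U V W : lmodType R.

Definition lin U V (f : U -> V)
    (fP : forall a x y, f (a *: x + y) = a *: f x + f y) : {linear U -> V} :=
  HB.pack f (GRing.isLinear.Build R U V *:%R f fP).

Definition lcomp U V W (g : {linear V -> W}) (f : {linear U -> V}) :
  {linear U -> W} := [the {linear U -> W} of g \o f].

Lemma linear_ext U V (f g : {linear U -> V}) : f =1 g -> f = g.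
Proof.
case: f g => [f [[f1] [f2]]] [g [[g1] [g2]]] /= /funext e; subst g.
by rewrite (Prop_irrelevance f1 g1) (Prop_irrelevance f2 g2).
Qed.

End Linear.

(** * The lattice of submodules *)

Section Submodules.
Variable R : pzRingType.

Section Build.
Variables (M : lmodType R) (Q : M -> Prop).
Hypotheses (Q0 : Q 0) (QL : forall a x y, Q x -> Q y -> Q (a *: x + y)).

Definition submod_of_pred : {pred M} := fun x => `[< Q x >].

Fact submod_of_closed : submod_closed submod_of_pred.
Proof.
split=> [|a x y /asboolP Qx /asboolP Qy]; apply/asboolP => //.
exact: QL.
Qed.

Definition submod_of : submodClosed M :=
  HB.pack submod_of_pred
    (GRing.isSubmodClosed.Build R M submod_of_pred submod_of_closed).

Lemma in_submod_of x : x \in submod_of <-> Q x.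
Proof. by split=> [/asboolP|h]; [|apply/asboolP]. Qed.

End Build.

Implicit Types M N : lmodType R.

Lemma submodN M (S : submodClosed M) x : x \in S -> - x \in S.
Proof. by move=> xS; rewrite -scaleN1r rpredZ. Qed.

Lemma submodB M (S : submodClosed M) x y : x \in S -> y \in S -> x - y \in S.
Proof. by move=> xS yS; rewrite rpredD ?submodN. Qed.

Definition sub0 M : submodClosed M.
refine (@submod_of M (fun x => x = 0) _ _) => // a x y -> ->.
by rewrite scaler0 addr0.
Defined.

Definition subT M : submodClosed M.
by refine (@submod_of M (fun=> True) _ _).
Defined.

Definition subI M (S T : submodClosed M) : submodClosed M.
refine (@submod_of M (fun x => x \in S /\ x \in T) _ _).
  by split; exact: rpred0.
by move=> a x y [xS xT] [yS yT]; split; rewrite rpredD ?rpredZ.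
Defined.

Definition subD M (S T : submodClosed M) : submodClosed M.
refine (@submod_of M (fun x => exists2 y, y \in S & x - y \in T) _ _).
  by exists 0; rewrite ?subr0 rpred0.
move=> a x y [x' x'S xT] [y' y'S yT]; exists (a *: x' + y').
  by rewrite rpredD ?rpredZ.
by rewrite opprD addrACA -scalerBr rpredD ?rpredZ.
Defined.

Definition subim M N (f : {linear M -> N}) (S : submodClosed M) : submodClosed N.
refine (@submod_of N (fun x => exists2 y, y \in S & x = f y) _ _).
  by exists 0; rewrite ?rpred0 ?linear0.
move=> a x y [x' x'S ->] [y' y'S ->]; exists (a *: x' + y').
  by rewrite rpredD ?rpredZ.
by rewrite linearP.
Defined.

Definition subpre M N (f : {linear M -> N}) (T : submodClosed N) : submodClosed M.
refine (@submod_of M (fun x => f x \in T) _ _).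
  by rewrite linear0 rpred0.
by move=> a x y xT yT; rewrite linearP rpredD ?rpredZ.
Defined.

Definition cyclic_sub M (x : M) : submodClosed M.
refine (@submod_of M (fun y => exists a, y = a *: x) _ _).
  by exists 0; rewrite scale0r.
by move=> a y z [b ->] [c ->]; exists (a * b + c); rewrite scalerDl scalerA.
Defined.

Definition subspan M (s : seq M) : submodClosed M.
refine (@submod_of M (fun y => forall T : submodClosed M,
  (forall x, x \in s -> x \in T) -> y \in T) _ _).
  by move=> T _; exact: rpred0.
by move=> a x y hx hy T sT; rewrite rpredD ?rpredZ ?hx ?hy.
Defined.

Lemma in_sub0 M (x : M) : x \in sub0 M <-> x = 0.
Proof. exact: in_submod_of. Qed.
Lemma in_subT M (x : M) : x \in subT M.
Proof. exact/in_submod_of. Qed.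
Lemma in_subI M (S T : submodClosed M) x : x \in subI S T <-> x \in S /\ x \in T.
Proof. exact: in_submod_of. Qed.
Lemma in_subD M (S T : submodClosed M) x :
  x \in subD S T <-> exists2 y, y \in S & x - y \in T.
Proof. exact: in_submod_of. Qed.
Lemma in_subim M N (f : {linear M -> N}) (S : submodClosed M) x :
  x \in subim f S <-> exists2 y, y \in S & x = f y.
Proof. exact: in_submod_of. Qed.
Lemma in_subpre M N (f : {linear M -> N}) (T : submodClosed N) x :
  x \in subpre f T <-> f x \in T.
Proof. exact: in_submod_of. Qed.
Lemma in_cyclic_sub M (x y : M) : y \in cyclic_sub x <-> exists a, y = a *: x.
Proof. exact: in_submod_of. Qed.
Lemma in_subspan M (s : seq M) y :
  y \in subspan s <-> forall T : submodClosed M,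
    (forall x, x \in s -> x \in T) -> y \in T.
Proof. exact: in_submod_of. Qed.

Lemma mem_subim M N (f : {linear M -> N}) (S : submodClosed M) x :
  x \in S -> f x \in subim f S.
Proof. by move=> xS; apply/in_subim; exists x. Qed.

Lemma mem_subspan M (s : seq M) x : x \in s -> x \in subspan s.
Proof. by move=> xs; apply/in_subspan => T; exact. Qed.

Lemma subDl M (S T : submodClosed M) : {subset S <= subD S T}.
Proof. by move=> x xS; apply/in_subD; exists x; rewrite ?subrr ?rpred0. Qed.
Lemma subDr M (S T : submodClosed M) : {subset T <= subD S T}.
Proof. by move=> x xT; apply/in_subD; exists 0; rewrite ?subr0 ?rpred0. Qed.

(* [W] is a submodule maximal among those that contain [S] and avoid [x]. *)
Lemma maximal_avoiding M (S : submodClosed M) (x : M) : x \notin S ->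
  exists2 W : submodClosed M, {subset S <= W} /\ x \notin W &
    forall y, y \notin W -> x \in subD W (cyclic_sub y).
Proof.
move=> xS.
(* Stability under adding elements of [S] replaces inclusion of [S], so that the empty set qualifies
   as the union of an empty chain. That the maximal set contains 0 is proved afterwards. *)
pose P (Z : classical_sets.set M) :=
  [/\ forall a y z, Z y -> Z z -> Z (a *: y + z),
      forall y z, Z y -> z \in S -> Z (y + z) & ~ Z x].
have chain F : classical_sets.subset F P ->
    classical_sets.total_on F classical_sets.subset ->
    P (classical_sets.bigcup F id).
  move=> FP tot; split.
  - move=> a y z [Y FY Yy] [Z FZ Zz].
    have [YZ|ZY] := tot _ _ FY FZ.
      by exists Z => //; have [L _ _] := FP _ FZ; apply: L => //; exact: YZ.
    by exists Y => //; have [L _ _] := FP _ FY; apply: L => //; exact: ZY.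
  - move=> y z [Y FY Yy] zS; exists Y => //.
    by have [_ L _] := FP _ FY; apply: L.
  - by move=> [Y FY Yx]; have [_ _] := FP _ FY; exact.
have [Z [PZ maxZ]] := classical_sets.Zorn_bigcup chain.
have Z0 : Z 0.
  apply: contrapT => nZ0.
  have nZ y : ~ Z y.
    move=> Zy; apply: nZ0; have [L _ _] := PZ.
    by have := L (-1) y y Zy Zy; rewrite scaleN1r addNr.
  apply: (maxZ (fun y => y \in S)).
    split; last by move=> SZ; apply: nZ0; apply: SZ; exact: rpred0.
    by move=> y /nZ.
  split=> [a y z yS zS|y z yS zS|]; rewrite ?rpredD ?rpredZ //.
  by move=> xS'; rewrite xS' in xS.
have [ZL ZS Zx] := PZ.
pose W := @submod_of M Z Z0 ZL.
have WP y : y \in W <-> Z y by exact: in_submod_of.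
exists W; first split.
- by move=> y yS; apply/WP; rewrite -[y]add0r; exact: ZS.
- by apply/negP => /WP.
move=> y yW; apply: contrapT => xD.
apply: (maxZ (fun z => z \in subD W (cyclic_sub y))).
  split; first by move=> z /WP; exact: subDl.
  move=> DZ; move/negP: yW; apply; apply/WP; apply: DZ; apply: subDr.
  by apply/in_cyclic_sub; exists 1; rewrite scale1r.
split=> //.
- by move=> a u v uD vD; rewrite rpredD ?rpredZ.
- move=> u v uD vS; rewrite rpredD //; apply: subDl; apply/WP.
  by rewrite -[v]add0r; exact: ZS.
Qed.

End Submodules.

Arguments subT {R M}.
Arguments sub0 {R M}.

(** * Modules of finite length *)

Section Ranked.
Variable R : pzRingType.
Implicit Types M N : lmodType R.

(* [S] has composition length at most [b], witnessed by a strictly monotone   *)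
(* function on the submodules of [S].                                         *)
Definition ranked M (S : submodClosed M) (b : nat) : Prop :=
  exists r : submodClosed M -> nat,
  [/\ forall T : submodClosed M, {subset T <= S} -> (r T <= b)%N,
      forall T T' : submodClosed M, {subset T <= T'} -> {subset T' <= S} ->
        (r T <= r T')%N &
      forall T T' : submodClosed M, {subset T <= T'} -> {subset T' <= S} ->
        (r T' <= r T)%N -> {subset T' <= T}].

Lemma ranked0 M (S : submodClosed M) : (forall x, x \in S -> x = 0) -> ranked S 0.
Proof.
move=> S0; exists (fun=> 0%N); split=> // T T' _ sT' _ x /sT'/S0 ->.
exact: rpred0.
Qed.

Lemma ranked_sub M (S T : submodClosed M) b :
  {subset T <= S} -> ranked S b -> ranked T b.
Proof.
move=> TS [r [rb rm rs]]; exists r; split.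
- by move=> U UT; apply: rb => x /UT/TS.
- by move=> U U' UU' U'T; apply: rm => // x /U'T/TS.
- by move=> U U' UU' U'T; apply: rs => // x /U'T/TS.
Qed.

(** Nested submodules with the same image under [f] and the same intersection with its kernel
    coincide, so adding the two ranks gives a strictly monotone function. *)
Lemma ranked_ext M N (f : {linear M -> N}) (S : submodClosed M) a b :
  ranked (subI S (subpre f sub0)) a -> ranked (subim f S) b -> ranked S (a + b).
Proof.
move=> [r [rb rm rs]] [r' [rb' rm' rs']].
pose K := subpre f sub0.
have subK (T T' : submodClosed M) : {subset T <= T'} ->
    {subset subI T K <= subI T' K}.
  by move=> TT' x /in_subI[/TT' xT' xK]; apply/in_subI.
have subF (T T' : submodClosed M) : {subset T <= T'} ->
    {subset subim f T <= subim f T'}.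
  by move=> TT' x /in_subim[y /TT' yT' ->]; exact: mem_subim.
exists (fun T => r (subI T K) + r' (subim f T))%N; split.
- by move=> T TS; apply: leq_add; [apply: rb | apply: rb']; auto.
- by move=> T T' TT' T'S; apply: leq_add; [apply: rm | apply: rm']; auto.
- move=> T T' TT' T'S le x xT'.
  have h1 := rm _ _ (subK _ _ TT') (subK _ _ T'S).
  have h2 := rm' _ _ (subF _ _ TT') (subF _ _ T'S).
  have l1 : (r (subI T' K) <= r (subI T K))%N.
    by rewrite -(leq_add2r (r' (subim f T))) (leq_trans _ le) // leq_add2l.
  have l2 : (r' (subim f T') <= r' (subim f T))%N.
    by rewrite -(leq_add2l (r (subI T K))) (leq_trans _ le) // leq_add2r.
  have e1 := rs _ _ (subK _ _ TT') (subK _ _ T'S) l1.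
  have e2 := rs' _ _ (subF _ _ TT') (subF _ _ T'S) l2.
  have /e2/in_subim[y yT fxy] : f x \in subim f T' by exact: mem_subim.
  have /e1/in_subI[xyT _] : x - y \in subI T' K.
    apply/in_subI; split; first by rewrite submodB // TT'.
    by apply/in_subpre/in_sub0; rewrite linearB /= fxy subrr.
  by rewrite -[x](subrK y) rpredD.
Qed.

Lemma ranked_inj M N (f : {linear M -> N}) (S : submodClosed N) b :
  injective f -> ranked S b -> ranked (subpre f S) b.
Proof.
move=> finj rS; apply: (@ranked_ext _ _ f _ 0).
  apply: ranked0 => x /in_subI[_ /in_subpre/in_sub0 fx0].
  by apply: finj; rewrite fx0 linear0.
by apply: ranked_sub rS => x /in_subim[y /in_subpre ? ->].
Qed.

Lemma ranked_im M N (f : {linear M -> N}) (S : submodClosed M) b :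
  ranked S b -> ranked (subim f S) b.
Proof.
move=> [r [rb rm rs]].
have m (T T' : submodClosed N) : {subset T <= T'} ->
    {subset subI S (subpre f T) <= subI S (subpre f T')}.
  by move=> TT' x /in_subI[xS /in_subpre/TT' ?]; apply/in_subI; split=> //; apply/in_subpre.
have inS (T : submodClosed N) : {subset subI S (subpre f T) <= S}.
  by move=> x /in_subI[].
exists (fun T => r (subI S (subpre f T))); split.
- by move=> T _; apply: rb.
- by move=> T T' TT' _; apply: rm => //; exact: m.
- move=> T T' TT' T'S le x xT'.
  have /in_subim[y yS exy] := T'S _ xT'; rewrite exy.
  have /(rs _ _ (m _ _ TT') (@inS _) le) : y \in subI S (subpre f T').
    by apply/in_subI; split=> //; apply/in_subpre; rewrite -exy.
  by move=> /in_subI[_ /in_subpre].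
Qed.

(** The same argument for the second isomorphism theorem: a submodule [U] of S + T is measured by
    its intersection with S and by the intersection of U + S with T. *)
Lemma ranked_sum M (S T : submodClosed M) a b :
  ranked S a -> ranked T b -> ranked (subD S T) (a + b).
Proof.
move=> [r [rb rm rs]] [r' [rb' rm' rs']].
pose F U := subI U S; pose G U := subI (subD U S) T.
have Fm (U U' : submodClosed M) : {subset U <= U'} -> {subset F U <= F U'}.
  by move=> UU' x /in_subI[/UU' xU' xS]; apply/in_subI.
have Gm (U U' : submodClosed M) : {subset U <= U'} -> {subset G U <= G U'}.
  move=> UU' x /in_subI[/in_subD[y /UU' yU' xy] xT]; apply/in_subI; split=> //.
  by apply/in_subD; exists y.
have FS U : {subset F U <= S} by move=> x /in_subI[].
have GT U : {subset G U <= T} by move=> x /in_subI[].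
exists (fun U => r (F U) + r' (G U))%N; split.
- by move=> U _; apply: leq_add; auto.
- by move=> U U' UU' _; apply: leq_add; auto.
- move=> U U' UU' U'D le x xU'.
  have h1 := rm _ _ (Fm _ _ UU') (@FS _).
  have h2 := rm' _ _ (Gm _ _ UU') (@GT _).
  have l1 : (r (F U') <= r (F U))%N.
    by rewrite -(leq_add2r (r' (G U))) (leq_trans _ le) // leq_add2l.
  have l2 : (r' (G U') <= r' (G U))%N.
    by rewrite -(leq_add2l (r (F U))) (leq_trans _ le) // leq_add2r.
  have e1 := rs _ _ (Fm _ _ UU') (@FS _) l1.
  have e2 := rs' _ _ (Gm _ _ UU') (@GT _) l2.
  have /in_subD[w wS kT] := U'D _ xU'.
  have /e2/in_subI[/in_subD[t tU twS] _] : x - w \in G U'.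
    apply/in_subI; split=> //; apply/in_subD; exists x => //.
    by rewrite addrAC subrr add0r submodN.
  have /e1/in_subI[xtU _] : x - t \in F U'.
    apply/in_subI; split; first by rewrite submodB // UU'.
    have -> : x - t = x - w - t + w by rewrite addrAC subrK.
    by rewrite rpredD.
  by rewrite -[x](subrK t) rpredD.
Qed.

Lemma ranked_max M (S : submodClosed M) b (P : submodClosed M -> Prop) :
    ranked S b -> (exists2 T : submodClosed M, {subset T <= S} & P T) ->
  exists T : submodClosed M, [/\ {subset T <= S}, P T &
    forall T' : submodClosed M, {subset T' <= S} -> P T' -> {subset T <= T'} ->
      {subset T' <= T}].
Proof.
move=> [r [rb rm rs]] [T0 T0S PT0].
have [||n [T [TS PT <-]] maxT] := @ex_max_nat
  (fun n => exists T : submodClosed M, [/\ {subset T <= S}, P T & r T = n]) b.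
- by exists (r T0), T0.
- by move=> n [T [TS _ <-]]; exact: rb.
exists T; split=> // T' T'S PT' TT'; apply: rs => //; apply: maxT.
by exists T'.
Qed.

Lemma ranked_min M (S : submodClosed M) b (P : submodClosed M -> Prop) :
    ranked S b -> (exists2 T : submodClosed M, {subset T <= S} & P T) ->
  exists T : submodClosed M, [/\ {subset T <= S}, P T &
    forall T' : submodClosed M, P T' -> {subset T' <= T} -> {subset T <= T'}].
Proof.
move=> [r [rb rm rs]] [T0 T0S PT0].
have [|n [T [TS PT <-]] minT] := @ex_min_nat
  (fun n => exists T : submodClosed M, [/\ {subset T <= S}, P T & r T = n]).
  by exists (r T0), T0.
exists T; split=> // T' PT' T'T; apply: rs => //; apply: minT.
by exists T'; split=> // x /T'T/TS.
Qed.

Lemma ranked_strict_sub M N (f : {linear N -> M}) b :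
    ranked (@subT R M) b -> injective f -> (exists y, forall x, f x != y) ->
  exists2 b', (b' < b)%N & ranked (@subT R N) b'.
Proof.
move=> [r [rb rm rs]] finj [y fy].
have inT (M' : lmodType R) (T : submodClosed M') : {subset T <= subT}.
  by move=> x _; exact: in_subT.
have lt T : (r (subim f T) < b)%N.
  apply: leq_trans (rb subT (fun x h => h)); rewrite ltnNge; apply/negP => le.
  have /in_subim[x _ /eqP] := rs _ _ (@inT _ _) (@inT _ _) le y (in_subT y).
  by rewrite eq_sym (negbTE (fy x)).
exists b.-1; first by rewrite prednK // (leq_trans _ (lt sub0)).
have m (T T' : submodClosed N) : {subset T <= T'} ->
    {subset subim f T <= subim f T'}.
  by move=> TT' x /in_subim[z /TT' zT' ->]; exact: mem_subim.
exists (fun T => r (subim f T)); split.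
- by move=> T _; rewrite -ltnS prednK // (leq_trans _ (lt sub0)).
- by move=> T T' TT' _; apply: rm (@inT _ _); exact: m.
- move=> T T' TT' _ le x xT'.
  have := rs _ _ (m _ _ TT') (@inT _ _) le (f x) (mem_subim _ xT').
  by move=> /in_subim[z zT /finj ->].
Qed.

Lemma ranked_strict_quot M N (f : {linear M -> N}) b :
    ranked (@subT R M) b -> (forall y, exists x, f x = y) ->
    (exists2 x, x != 0 & f x = 0) ->
  exists2 b', (b' < b)%N & ranked (@subT R N) b'.
Proof.
move=> [r [rb rm rs]] fsurj [x x0 fx0].
have inT (M' : lmodType R) (T : submodClosed M') : {subset T <= subT}.
  by move=> ? _; exact: in_subT.
have gt T : (0 < r (subpre f T))%N.
  apply: (@leq_ltn_trans (r sub0)) => //; rewrite ltnNge; apply/negP => le.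
  have s0 : {subset (@sub0 R M) <= subpre f T}.
    by move=> z /in_sub0 ->; apply/in_subpre; rewrite linear0 rpred0.
  have := rs _ _ s0 (@inT _ _) le x.
  rewrite in_subpre fx0 rpred0 => /(_ isT)/in_sub0 ex0.
  by rewrite ex0 eqxx in x0.
have m (T T' : submodClosed N) : {subset T <= T'} ->
    {subset subpre f T <= subpre f T'}.
  by move=> TT' z /in_subpre/TT' h; apply/in_subpre.
have b0 : (0 < b)%N by apply: leq_trans (gt subT) (rb _ (@inT _ _)).
exists b.-1; first by rewrite prednK.
exists (fun T => (r (subpre f T)).-1); split.
- by move=> T _; rewrite -ltnS !prednK // rb.
- by move=> T T' TT' _; rewrite -ltnS !prednK // rm //; exact: m.
- move=> T T' TT' _; rewrite -ltnS !prednK // => le y yT'.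
  have [z fz] := fsurj y; rewrite -fz; apply/in_subpre.
  apply: (rs _ _ (m _ _ TT') (@inT _ _) le); apply/in_subpre.
  by rewrite fz.
Qed.

End Ranked.

(** * Commutative artinian rings have finite length *)

Section CommutativeArtinian.
Variable k : comPzRingType.
Hypothesis k_art : artinian k.
Implicit Types I J : submodClosed k^o.

Lemma artinian_min (P : submodClosed k^o -> Prop) : (exists I, P I) ->
  exists2 I, P I & forall J, P J -> {subset J <= I} -> {subset I <= J}.
Proof.
move=> [I0 PI0]; apply: contrapT => nmin.
have step (u : {I | P I}) :
    exists v : {I | P I}, {subset sval v <= sval u} /\ ~ {subset sval u <= sval v}.
  case: u => I PI; apply: contrapT => nv; apply: nmin; exists I => // J PJ JI.
  by apply: contrapT => nIJ; apply: nv; exists (exist _ J PJ).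
have [f fP] := choice step.
pose u n := iter n f (exist _ I0 PI0).
have [n un] := k_art (fun n => (fP (u n)).1).
apply: (fP (u n)).2 => x.
by rewrite -(un n.+1 (leqnSn n)).
Qed.

Definition mulk (c : k) : {linear k^o -> k^o}.
refine (@lin k k^o k^o (fun x => c * x) _) => a x y.
by rewrite mulrDr; congr (_ + _); rewrite mulrCA.
Defined.

Let mulI c I : {subset subim (mulk c) I <= I}.
Proof. by move=> x /in_subim[y yI ->]; exact: (rpredZ c). Qed.

Lemma power_stationary (c : k) : exists n d, c ^+ n = c ^+ n.+1 * d.
Proof.
have dec n : {subset cyclic_sub (c ^+ n.+1 : k^o) <= cyclic_sub (c ^+ n : k^o)}.
  move=> x /in_cyclic_sub[a ->]; apply/in_cyclic_sub; exists (a * c).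
  by rewrite exprS -[RHS]mulrA.
have [n /(_ n.+1 (leqnSn n)) e] := k_art dec.
have : (c ^+ n : k^o) \in cyclic_sub (c ^+ n.+1 : k^o).
  by rewrite e; apply/in_cyclic_sub; exists 1; rewrite scale1r.
by move=> /in_cyclic_sub[d ed]; exists n, d; rewrite mulrC.
Qed.

(* A minimal ideal [I] of infinite length satisfies [c I = 0] or [c I = I] for *)
(* every [c], so it is a vector space over a residue field; splitting off a    *)
(* line yields a proper subspace, of finite length by minimality.             *)
Lemma artinian_ranked : exists b, ranked (@subT k k^o) b.
Proof.
apply: contrapT => nT.
have [|I nI minI] := @artinian_min (fun I => ~ exists b, ranked I b).
  by exists subT.
have fin J : {subset J <= I} -> ~ {subset I <= J} -> exists b, ranked J b.
  by move=> JI nIJ; apply: contrapT => nJ; apply: nIJ; exact: minI.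
(* If c I and the kernel of c on I were both proper in I, minimality would give them finite length,
   and [ranked_ext] would give it to I. *)
have dich c : (forall x, x \in I -> c * x = 0) \/ {subset I <= subim (mulk c) I}.
  have [h|n1] := pselect {subset I <= subim (mulk c) I}; [by right | left].
  have [h x xI|n2] := pselect {subset I <= subI I (subpre (mulk c) sub0)}.
    by have /in_subI[_ /in_subpre/in_sub0] := h _ xI.
  case: nI; have [a ra] := fin _ (@mulI c I) n1.
  have [|b rb] := fin (subI I (subpre (mulk c) sub0)) _ n2.
    by move=> x /in_subI[].
  by exists (b + a)%N; exact: ranked_ext rb ra.
(* Here c I = I, hence c^n I = I for all n, and the d with c^n = c^(n+1) d inverts c on I. *)
have inv c : (exists2 x, x \in I & c * x != 0) ->
    exists d, forall x, x \in I -> d * (c * x) = x.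
  move=> [x0 x0I cx0].
  have cI : {subset I <= subim (mulk c) I}.
    by case: (dich c) => // h; rewrite h // eqxx in cx0.
  have cnI n : {subset I <= subim (mulk (c ^+ n)) I}.
    elim: n => [|n IH] x xI.
      by apply/in_subim; exists x => //=; rewrite expr0 mul1r.
    have /in_subim[y yI ->] := IH _ xI; have /in_subim[z zI ->] := cI _ yI.
    by apply/in_subim; exists z => //=; rewrite exprSr mulrA.
  have [n [d e]] := power_stationary c; exists d => x xI.
  have /in_subim[y yI /= ->] := cnI n _ xI.
  by rewrite [in RHS]e exprS !mulrA; congr (_ * _); rewrite -mulrA mulrC.
have [x xI x0] : exists2 x, x \in I & x != 0.
  apply: contrapT => h; apply: nI; exists 0%N; apply: ranked0 => x xI.
  by apply: contrapT => /eqP x0; apply: h; exists x.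
have x_notin0 : (x : k^o) \notin (@sub0 k k^o) by apply/negP => /in_sub0 /eqP; exact/negP.
have [W [_ xW] Wmax] := maximal_avoiding x_notin0.
have [a ra] : exists a, ranked (subI W I) a.
  apply: fin => [y /in_subI[]//|h].
  by have /in_subI[xW' _] := h _ xI; rewrite xW' in xW.
(* The line spanned by x is simple: a submodule of it with a nonzero element c x contains x, because
   c is invertible on I. So membership of x is a rank. *)
have rb : ranked (cyclic_sub (x : k^o)) 1.
  exists (fun T : submodClosed k^o => nat_of_bool (x \in T)); split=> [T _|T T' TT' _|T T' TT' T'x].
  - exact: leq_b1.
  - by case xT: (x \in T); rewrite // TT'.
  - case xT: (x \in T) => /=.
      by move=> _ y /T'x/in_cyclic_sub[c ->]; exact: rpredZ.
    case xT': (x \in T') => // _ y yT'.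
    have /in_cyclic_sub[c ey] := T'x _ yT'.
    have [cx0|cx0] := eqVneq (c * x) 0.
      by rewrite ey [c *: _]cx0 rpred0.
    have [|d dP] := inv c; first by exists x.
    have : d *: y \in T' by rewrite rpredZ.
    by rewrite ey [_ *: _]dP // xT'.
apply: nI; exists (a + 1)%N; apply: ranked_sub (ranked_sum ra rb) => y yI.
have [yW|yW] := boolP (y \in W).
  by apply: subDl; apply/in_subI.
have /in_subD[w wW /in_cyclic_sub[c ec]] := Wmax _ yW.
have [|d dP] := inv c.
  exists y => //; apply/eqP => cy0; move/negP: xW; apply.
  by move: ec; rewrite [c *: _]cy0 => /eqP; rewrite subr_eq0 => /eqP ->.
have ey : y = d * (x - w) by rewrite ec [RHS]dP.
have wI : w \in I.
  have -> : w = x - c *: y by rewrite -ec opprB addrCA subrr addr0.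
  by rewrite submodB ?rpredZ.
apply/in_subD; exists (- d * w).
  by apply/in_subI; split; exact: (rpredZ (- d)).
by apply/in_cyclic_sub; exists d; rewrite ey mulrBr mulNr opprK subrK.
Qed.

End CommutativeArtinian.

Arguments artinian_ranked {k}.

(** * Restriction of scalars and quotient modules *)

Definition restrict (R S : pzRingType) (phi : {rmorphism R -> S})
  (N : lmodType S) : Type := N.

Section Restriction.
Variables (R S : pzRingType) (phi : {rmorphism R -> S}) (N : lmodType S).

HB.instance Definition _ := GRing.Zmodule.on (restrict phi N).

Let scale (a : R) (x : restrict phi N) : restrict phi N := phi a *: (x : N).

Fact restrict_scaleA a b x : scale a (scale b x) = scale (a * b) x.
Proof. by rewrite /scale rmorphM scalerA. Qed.
Fact restrict_scale1 : left_id 1 scale.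
Proof. by move=> x; rewrite /scale rmorph1 scale1r. Qed.
Fact restrict_scaleDr : right_distributive scale +%R.
Proof. by move=> a x y; exact: scalerDr. Qed.
Fact restrict_scaleDl x : {morph scale^~ x : a b / a + b}.
Proof. by move=> a b; rewrite /scale rmorphD scalerDl. Qed.

HB.instance Definition _ :=
  GRing.Zmodule_isLmodule.Build R (restrict phi N)
    restrict_scaleA restrict_scale1 restrict_scaleDr restrict_scaleDl.

Lemma restrict_scaleE (a : R) (x : restrict phi N) : a *: x = phi a *: (x : N) :> N.
Proof. by []. Qed.

End Restriction.

Section QuotientModule.
Variables (R : pzRingType) (M : lmodType R) (S : submodClosed M).

Definition submod_pred : {pred M} := S.
Fact submod_pred_zmod_closed : zmod_closed submod_pred.
Proof. by split=> [|x y xS yS]; [exact: rpred0 | exact: submodB]. Qed.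
HB.instance Definition _ :=
  GRing.isZmodClosed.Build M submod_pred submod_pred_zmod_closed.

Definition quot_mod : Type := Quotient.quot submod_pred.
HB.instance Definition _ := GRing.Zmodule.on quot_mod.

Definition qproj (x : M) : quot_mod := (\pi_(Quotient.quot submod_pred) x)%qT.
Definition qrepr (x : quot_mod) : M := repr (x : Quotient.quot submod_pred).

Lemma qprojP x y : qproj x = qproj y <-> x - y \in S.
Proof.
have -> : (x - y \in S) = (x - y \in submod_pred) by [].
by rewrite Quotient.idealrBE; split=> /eqP.
Qed.

Lemma qreprK : cancel qrepr qproj.
Proof. exact: reprK. Qed.

Let scale (a : R) (x : quot_mod) : quot_mod := qproj (a *: qrepr x).

Fact qproj_scale a x : qproj (a *: x) = scale a (qproj x).
Proof. by apply/qprojP; rewrite -scalerBr rpredZ //; apply/qprojP; rewrite qreprK. Qed.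
Fact qprojD x y : qproj (x + y) = qproj x + qproj y.
Proof. exact: Quotient.pi_add. Qed.

Fact quot_scaleA a b x : scale a (scale b x) = scale (a * b) x.
Proof. by rewrite -(qreprK x) -!qproj_scale scalerA. Qed.
Fact quot_scale1 : left_id 1 scale.
Proof. by move=> x; rewrite -(qreprK x) -!qproj_scale scale1r. Qed.
Fact quot_scaleDr : right_distributive scale +%R.
Proof.
by move=> a x y; rewrite -(qreprK x) -(qreprK y) -qprojD -!qproj_scale -qprojD scalerDr.
Qed.
Fact quot_scaleDl x : {morph scale^~ x : a b / a + b}.
Proof. by move=> a b; rewrite -(qreprK x) -!qproj_scale -qprojD scalerDl. Qed.

HB.instance Definition _ :=
  GRing.Zmodule_isLmodule.Build R quot_mod
    quot_scaleA quot_scale1 quot_scaleDr quot_scaleDl.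

Definition qmap : {linear M -> quot_mod}.
by refine (@lin R M quot_mod qproj _) => a x y; rewrite qprojD qproj_scale.
Defined.

Lemma qmap_eq0 x : qmap x = 0 <-> x \in S.
Proof.
have <- : qproj 0 = 0 by exact: raddf0 qmap.
by have := qprojP x 0; rewrite subr0.
Qed.

Lemma qmap_surj y : exists x, qmap x = y.
Proof. by exists (qrepr y); exact: qreprK. Qed.

Section Factor.
Variables (N : lmodType R) (f : {linear M -> N}).
Hypothesis fS : forall x, x \in S -> f x = 0.

Let factorE x : f (qrepr (qproj x)) = f x.
Proof.
apply/eqP; rewrite -subr_eq0 -linearB; apply/eqP/fS.
by apply/qprojP; rewrite qreprK.
Qed.

Definition qfactor : {linear quot_mod -> N}.
refine (@lin R quot_mod N (fun x => f (qrepr x)) _) => a x y.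
rewrite -(qreprK x) -(qreprK y) -[_ *: _]qproj_scale -qprojD !factorE.
exact: linearP.
Defined.

Lemma qfactorE x : qfactor (qmap x) = f x.
Proof. exact: factorE. Qed.

End Factor.
End QuotientModule.

(** * Finite generation and finite direct sums *)

Section FiniteGeneration.
Variable R : pzRingType.
Implicit Types M N : lmodType R.

Lemma fgP M : finitely_generated M <-> exists s : seq M, forall x, x \in subspan s.
Proof.
split=> [[n [v vP]]|[s sP]].
  exists (codom v) => x; have [a ->] := vP x; apply/in_subspan => T vT.
  by apply: rpred_sum => i _; apply: rpredZ; apply: vT; exact: codom_f.
exists (size s), (fun i => s`_i).
have Q0 : exists a : 'I_(size s) -> R, 0 = \sum_i a i *: s`_i.
  by exists (fun=> 0); rewrite big1 // => i _; rewrite scale0r.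
have QL a x y : (exists a : 'I_(size s) -> R, x = \sum_i a i *: s`_i) ->
    (exists a : 'I_(size s) -> R, y = \sum_i a i *: s`_i) ->
    exists a' : 'I_(size s) -> R, a *: x + y = \sum_i a' i *: s`_i.
  move=> [b ->] [c ->]; exists (fun i => a * b i + c i).
  rewrite scaler_sumr -big_split /=; apply: eq_bigr => i _.
  by rewrite scalerDl scalerA.
move=> x; have /in_subspan/(_ (submod_of Q0 QL)) := sP x.
move=> h; apply/(in_submod_of Q0 QL)/h => y ys; apply/in_submod_of.
have lt : (index y s < size s)%N by rewrite index_mem.
exists (fun i => (i == Ordinal lt)%:R).
rewrite (bigD1 (Ordinal lt)) //= eqxx scale1r nth_index // big1 ?addr0 //.
by move=> i /negbTE ->; rewrite scale0r.
Qed.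

Lemma fg_surj M N (f : {linear M -> N}) :
  (forall y, exists x, f x = y) -> finitely_generated M -> finitely_generated N.
Proof.
move=> fs /fgP[s sP]; apply/fgP; exists (map f s) => y.
have [x <-] := fs y; apply/in_subspan => T sT.
have /in_subspan/(_ (subpre f T)) := sP x.
move=> h; apply/in_subpre/h => z zs; apply/in_subpre/sT.
exact: map_f.
Qed.

(** A maximal finitely generated submodule of [S] absorbs every element of [S]. *)
Lemma ranked_fg_sub M b (S : submodClosed M) :
  ranked (@subT R M) b -> finitely_generated (submodule S).
Proof.
move=> rM.
have [|T [_ [s sS Ts] maxT]] := @ranked_max _ _ _ _
    (fun T : submodClosed M => exists2 s : seq M, {subset s <= S} & T =i subspan s) rM.
  exists (subspan [::]); first by move=> x _; exact: in_subT.
  by exists [::].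
have ST : {subset S <= T}.
  move=> x xS.
  have xs : {subset subspan (x :: s) <= T}.
    apply: maxT.
    - by move=> z _; exact: in_subT.
    - by exists (x :: s) => // z; rewrite inE => /orP[/eqP->|/sS].
    - move=> z; rewrite Ts => /in_subspan zs; apply/in_subspan => U sU.
      by apply: zs => w ws; apply: sU; rewrite inE ws orbT.
  by apply: xs; apply: mem_subspan; exact: mem_head.
apply/fgP; exists (pmap insub s) => -[x xS]; apply/in_subspan => U sU.
pose v : {linear submodule S -> M} := [the {linear _ -> _} of val].
have /ST : x \in S by [].
rewrite Ts => /in_subspan/(_ (subim v U)) h.
have /in_subim[z zU exz] : x \in subim v U.
  apply: h => w ws; apply/in_subim; exists (Sub w (sS _ ws)); last by [].
  by apply: sU; rewrite mem_pmap; apply/mapP; exists w => //; symmetry; exact: insubT.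
have -> : exist _ x xS = z by apply: val_inj.
exact: zU.
Qed.

Lemma ranked_subspan M b (s : seq M) :
  ranked (@subT R R^o) b -> exists b', ranked (subspan s) b'.
Proof.
move=> rR; elim: s => [|x s [b' IH]].
  exists 0%N; apply: ranked0 => x /in_subspan/(_ sub0) h.
  exact/in_sub0/h.
have fP (a : R) (c d : R^o) :
    ((a *: c + d : R^o) : R) *: x = a *: ((c : R) *: x) + (d : R) *: x.
  by rewrite scalerDl scalerA.
exists (b + b')%N.
apply: ranked_sub (ranked_sum (ranked_im (@lin R R^o M (fun c => (c : R) *: x) fP) rR) IH).
move=> y /in_subspan; apply=> z; rewrite inE => /orP[/eqP->|zs].
  by apply: subDl; apply/in_subim; exists 1; [exact: in_subT | rewrite /= scale1r].
by apply: subDr; exact: mem_subspan.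
Qed.

End FiniteGeneration.

Section DirectSumMaps.
Variables (R : pzRingType) (n : nat) (X : 'I_n -> lmodType R).

Definition dproj (i : 'I_n) : {linear dsum X -> X i}.
by refine (@lin R (dsum X) (X i) (fun u => u i) _).
Defined.

Definition dinj (i : 'I_n) : {linear X i -> dsum X}.
refine (@lin R (X i) (dsum X) (fun x => dfwith (0 : dsum X) x) _) => a x y.
apply: functional_extensionality_dep => j.
rewrite -[RHS]/(a *: (dfwith (0 : dsum X) x j) + dfwith (0 : dsum X) y j).
have [<-|ij] := eqVneq i j; first by rewrite !dfwith_in.
by rewrite !dfwith_out //= scaler0 addr0.
Defined.

Lemma dinjK i : cancel (dinj i) (dproj i).
Proof. by move=> x; exact: dfwith_in. Qed.

Lemma dproj_dinj i j x : i != j -> dproj j (dinj i x) = 0.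
Proof. by move=> ij; exact: (dfwith_out (0 : dsum X)). Qed.

Lemma dsum_decomp (u : dsum X) : u = \sum_i dinj i (dproj i u).
Proof.
apply: functional_extensionality_dep => j.
have e : u j = \sum_i dproj j (dinj i (dproj i u)).
  rewrite (bigD1 j) //= big1 => [|i ij]; last exact: dproj_dinj.
  by rewrite addr0; symmetry; exact: dinjK.
by rewrite e -linear_sum.
Qed.

Lemma fg_dsum : (forall i, finitely_generated (X i)) -> finitely_generated (dsum X).
Proof.
move=> fgX.
have [s sP] : {s : forall i, seq (X i) & forall i x, x \in subspan (s i)}.
  have h i : {s : seq (X i) | forall x, x \in subspan s}.
    by apply: cid; apply/fgP.
  by exists (fun i => sval (h i)) => i; exact: svalP (h i).
apply/fgP; exists (flatten [seq map (dinj i) (s i) | i <- enum 'I_n]) => u.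
apply/in_subspan => T sT; rewrite [u]dsum_decomp; apply: rpred_sum => i _.
have /in_subspan/(_ (subpre (dinj i) T)) h := sP i (dproj i u).
apply/in_subpre/h => z zs; apply/in_subpre/sT/flatten_mapP.
by exists i; rewrite ?mem_enum //; exact: map_f.
Qed.

End DirectSumMaps.

(** The two modules live over different rings and [e] is not assumed linear: it is the identity both
    when scalars are restricted and when right ideals are viewed as submodules over central
    scalars. *)
Lemma ranked_transfer (R S : pzRingType) (M : lmodType R) (N : lmodType S)
    (e : N -> M) (conv : submodClosed N -> submodClosed M) b :
  (forall y, exists x, y = e x) -> (forall T x, e x \in conv T <-> x \in T) ->
  ranked (@subT R M) b -> ranked (@subT S N) b.
Proof.
move=> esurj convP [r [rb rm rs]].
have inT (T : submodClosed M) : {subset T <= subT} by move=> x _; exact: in_subT.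
have m (T T' : submodClosed N) : {subset T <= T'} -> {subset conv T <= conv T'}.
  by move=> TT' y; have [x ->] := esurj y; move=> /convP/TT'/convP.
exists (fun T => r (conv T)); split.
- by move=> T _; apply: rb.
- by move=> T T' TT' _; apply: rm (@inT _); exact: m.
- move=> T T' TT' _ le x /convP xT'; apply/convP.
  exact: (rs _ _ (m _ _ TT') (@inT _) le).
Qed.

Section RestrictFiniteness.
Variables (R S : pzRingType) (phi : {rmorphism R -> S}) (N : lmodType S).

Lemma fg_restrict :
    (exists (m : nat) (v : 'I_m -> S),
      forall a, exists c : 'I_m -> R, a = \sum_i phi (c i) * v i) ->
  finitely_generated N -> finitely_generated (restrict phi N).
Proof.
move=> [m [v vP]] [n [w wP]]; apply/fgP.
exists [seq (v i *: w j : restrict phi N) | i <- enum 'I_m, j <- enum 'I_n] => x.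
apply/in_subspan => T sT; have [a ->] := wP x.
apply: (@rpred_sum (restrict phi N)) => j _; have [c ->] := vP (a j).
rewrite scaler_suml; apply: (@rpred_sum (restrict phi N)) => i _.
rewrite -scalerA; apply: (@rpredZ _ (restrict phi N)); apply: sT.
by apply/allpairsP; exists (i, j); rewrite !mem_enum.
Qed.

Lemma ranked_restrict b :
  ranked (@subT R (restrict phi N)) b -> ranked (@subT S N) b.
Proof.
have Q0 (T : submodClosed N) : (0 : restrict phi N) \in T by exact: (@rpred0 N).
have QL (T : submodClosed N) (a : R) (x y : restrict phi N) :
    x \in T -> y \in T -> a *: x + y \in T.
  by move=> xT yT; apply: (@rpredD N) => //; exact: (rpredZ (phi a)).
apply: (@ranked_transfer _ _ _ _ (fun x : N => x : restrict phi N)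
  (fun T => submod_of (Q0 T) (QL T))).
- by move=> y; exists y.
- by move=> T x; exact: in_submod_of.
Qed.

End RestrictFiniteness.

Definition rmorph_of (R S : pzRingType) (f : R -> S)
    (fB : forall x y, f (x - y) = f x - f y) (f1 : f 1 = 1)
    (fM : forall x y, f (x * y) = f x * f y) : {rmorphism R -> S} :=
  HB.pack f (GRing.isZmodMorphism.Build R S f fB)
    (GRing.isMonoidMorphism.Build R S f (f1, fM)).

Definition ap (R : pzRingType) (M : lmodType R) (f : endo M) : {linear M -> M} := f.

Section EndoApply.
Variables (R : pzRingType) (M : lmodType R).
Implicit Types f g : endo M.

Lemma apM f g x : ap (f * g) x = ap f (ap g x). Proof. by []. Qed.
Lemma apD f g x : ap (f + g) x = ap f x + ap g x. Proof. by []. Qed.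
Lemma apB f g x : ap (f - g) x = ap f x - ap g x. Proof. by []. Qed.
Lemma ap1 x : ap (1 : endo M) x = x. Proof. by []. Qed.
Lemma ap_sum I (s : seq I) (F : I -> endo M) x :
  ap (\sum_(i <- s) F i) x = \sum_(i <- s) ap (F i) x.
Proof. by elim/big_rec2: _ => // i y1 y2 _ <-; rewrite apD. Qed.

Lemma ap_inj f g : ap f =1 ap g -> f = g.
Proof. exact: endoP. Qed.

End EndoApply.

Lemma linear_inj (R : pzRingType) (M N : lmodType R) (f : {linear M -> N}) :
  (forall x, f x = 0 -> x = 0) -> injective f.
Proof.
move=> f0 x y e; apply/eqP; rewrite -subr_eq0; apply/eqP/f0.
by rewrite linearB /= e subrr.
Qed.

Lemma linear_bij (R : pzRingType) (M N : lmodType R) (f : {linear M -> N}) :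
  (forall x, f x = 0 -> x = 0) -> (forall y, exists x, f x = y) -> bijective f.
Proof.
move=> /linear_inj finj /choice[g gK]; exists g => // x.
by apply: finj; rewrite gK.
Qed.

(** * Artin algebras *)

Section ArtinAlgebra.
Variable A : pzRingType.
Hypothesis hA : artin_algebra A.
Implicit Types M N : rmodType A.

Lemma artin_scalars : exists (k : comPzRingType) (s : {rmorphism k -> A^c}),
  [/\ exists b, ranked (@subT k k^o) b,
      forall c (x : A^c), s c * x = x * s c &
      exists (m : nat) (v : 'I_m -> A^c),
        forall x, exists c : 'I_m -> k, x = \sum_i s (c i) * v i].
Proof.
have [k [s [k_art sC [m [v vP]]]]] := hA.
have sB x y : s (x - y) = s x - s y :> A^c by rewrite rmorphB.
have s1 : s 1 = 1 :> A^c by rewrite rmorph1.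
have sM x y : s (x * y) = (s x : A^c) * s y by rewrite mulrC rmorphM.
exists k, (@rmorph_of k A^c s sB s1 sM); split.
- exact: artinian_ranked.
- by move=> c x; symmetry; exact: sC.
- exists m, v => x; have [c ->] := vP x; exists c; apply: eq_bigr => i _.
  exact: sC.
Qed.

Lemma artin_fg_ranked N : finitely_generated N -> exists b, ranked (@subT A^c N) b.
Proof.
have [k [s [[b kb] _ vP]]] := artin_scalars.
move=> /(fg_restrict (phi := s) vP)/fgP[l lP].
have [b' rb'] := ranked_subspan l kb; exists b'.
apply: ranked_restrict; apply: ranked_sub rb' => x _; exact: lP.
Qed.

Lemma fg_sub N (S : submodClosed N) :
  finitely_generated N -> finitely_generated (submodule S).
Proof. by move=> /artin_fg_ranked[b]; exact: ranked_fg_sub. Qed.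

(** Evaluation at n generators embeds the endomorphism ring, over the base ring k, into M^n, which
    has finite length over k. As k acts centrally, left and right ideals are k-submodules. *)
Lemma artin_endo_ranked M : finitely_generated M ->
  (exists b, ranked (@subT (endo M) (endo M)^o) b) /\
  (exists b, ranked (@subT (endo M)^c (endo M)^c^o) b).
Proof.
move=> fgM; have [k [s [[b kb] sC vP]]] := artin_scalars.
have hP c (a : A^c) (x y : M) :
    s c *: (a *: x + y) = a *: (s c *: x) + s c *: y.
  by rewrite scalerDr !scalerA sC.
pose h c : endo M := lin (hP c).
have hB c d : h (c - d) = h c - h d.
  by apply: ap_inj => x; rewrite apB /= rmorphB scalerBl.
have h1 : h 1 = 1 by apply: ap_inj => x; rewrite /= rmorph1 scale1r.
have hM c d : h (c * d) = h c * h d.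
  by apply: ap_inj => x; rewrite apM /= rmorphM scalerA.
pose sigma := rmorph_of hB h1 hM.
have sigmaC c (f : endo M) : sigma c * f = f * sigma c.
  by apply: ap_inj => x; rewrite !apM /= linearZ.
have [n [v gv]] := fgM.
pose V := dsum (fun _ : 'I_n => M).
have evP (c : k) (f g : restrict sigma (endo M)^o) :
    ((fun i => ap (c *: f + g : restrict sigma (endo M)^o) (v i)) : restrict s V) =
    c *: ((fun i => ap f (v i)) : restrict s V) + (fun i => ap g (v i)).
  by [].
pose ev : {linear restrict sigma (endo M)^o -> restrict s V} := lin evP.
have ev_inj : injective ev.
  move=> f g efg; apply: (@ap_inj _ _ f g) => x; have [a ->] := gv x.
  rewrite !linear_sum; apply: eq_bigr => i _; rewrite !linearZ; congr (_ *: _).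
  exact: (congr1 (fun u : V => u i) efg).
have [b' rb'] : exists b', ranked (@subT k (restrict s V)) b'.
  have /(fg_restrict (phi := s) vP)/fgP[l lP] : finitely_generated V.
    by apply: fg_dsum.
  have [b' rb'] := ranked_subspan l kb; exists b'.
  by apply: ranked_sub rb' => x _; exact: lP.
have rk : ranked (@subT k (restrict sigma (endo M)^o)) b'.
  apply: ranked_sub (ranked_inj ev_inj rb') => x _.
  by apply/in_subpre; exact: in_subT.
split; exists b'; first exact: ranked_restrict rk.
have Q0 (T : submodClosed (endo M)^c^o) :
    (0 : restrict sigma (endo M)^o) \in T by exact: (@rpred0 (endo M)^c^o).
have QL (T : submodClosed (endo M)^c^o) c (x y : restrict sigma (endo M)^o) :
    x \in T -> y \in T -> c *: x + y \in T.
  move=> xT yT; apply: (@rpredD (endo M)^c^o) => //.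
  rewrite restrict_scaleE -[_ *: _]/(sigma c * (x : endo M)) sigmaC.
  exact: (@rpredZ _ (endo M)^c^o T (sigma c)).
apply: (@ranked_transfer _ _ _ _
  (fun x : (endo M)^c^o => x : restrict sigma (endo M)^o)
  (fun T => submod_of (Q0 T) (QL T))) rk.
- by move=> y; exists y.
- by move=> T x; exact: in_submod_of.
Qed.

(** Induction on length, phrased without mentioning length. *)
Lemma strict_embedding_ind (P : rmodType A -> Prop) :
    (forall N, finitely_generated N ->
      (forall N' (f : {linear N' -> N}), finitely_generated N' -> injective f ->
         (exists y, forall x, f x != y) -> P N') -> P N) ->
  forall N, finitely_generated N -> P N.
Proof.
move=> IH N fgN; have [b rb] := artin_fg_ranked fgN.
elim/ltn_ind: b N fgN rb => b IHb N fgN rb; apply: IH => // N' f fgN' finj fns.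
have [b' lt rb'] := ranked_strict_sub rb finj fns.
exact: IHb rb'.
Qed.

Lemma fitting N (e : endo N) : finitely_generated N -> indecomposable N ->
  bijective (ap e) \/ exists n, e ^+ n = 0.
Proof.
move=> fgN [_ dec]; have [b rb] := artin_fg_ranked fgN.
have apX n d x : ap (e ^+ (n + d)) x = ap (e ^+ n) (ap (e ^+ d) x).
  by rewrite exprD.
have [|_ [_ [n1 ->] max1]] := ranked_max (P := fun T : submodClosed N =>
    exists n, T = subpre (ap (e ^+ n)) sub0) rb.
  by exists (subpre (ap (e ^+ 0)) sub0); [move=> x _; exact: in_subT | exists 0%N].
have [|_ [_ [n2 ->] min2]] := ranked_min (P := fun T : submodClosed N =>
    exists n, T = subim (ap (e ^+ n)) subT) rb.
  by exists (subim (ap (e ^+ 0)) subT); [move=> x _; exact: in_subT | exists 0%N].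
have ker d x : ap (e ^+ (d + n1)) x = 0 -> ap (e ^+ n1) x = 0.
  move=> ex; apply/in_sub0/in_subpre.
  apply: (max1 (subpre (ap (e ^+ (d + n1))) sub0)).
  - by move=> z _; exact: in_subT.
  - by exists (d + n1)%N.
  - move=> z /in_subpre/in_sub0 ez; apply/in_subpre/in_sub0.
    by rewrite apX ez linear0.
  - exact/in_subpre/in_sub0.
have im d x : exists y, ap (e ^+ n2) x = ap (e ^+ (n2 + d)) y.
  have /in_subim[y _ ->] : ap (e ^+ n2) x \in subim (ap (e ^+ (n2 + d))) subT.
    apply: min2; last by apply: mem_subim; exact: in_subT.
      by exists (n2 + d)%N.
    move=> z /in_subim[w _ ->]; rewrite apX; apply: mem_subim; exact: in_subT.
  by exists y.
(* Kernels and images of powers of e are stable from here on, so N is the direct sum of the image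
   and the kernel of e^n. The successor lets one factor e be split off on either side. *)
pose n := (n1 + n2).+1.
have kern x : ap (e ^+ n) (ap (e ^+ n) x) = 0 -> ap (e ^+ n) x = 0.
  have en : n = (n2.+1 + n1)%N by rewrite /n addSn addnC.
  rewrite -apX {2}en addnA => /(ker (n + n2.+1)%N x) ex.
  by rewrite en apX ex linear0.
have imn x : exists y, ap (e ^+ n) x = ap (e ^+ n) (ap (e ^+ n) y).
  have [y ey] := im n x; exists y.
  have en : n = (n1.+1 + n2)%N by rewrite /n addSn.
  by rewrite {1 2}en apX ey -!apX addnA.
have [||im0|ker0] := dec (subim (ap (e ^+ n)) subT) (subpre (ap (e ^+ n)) sub0).
- move=> x; have [y ey] := imn x; exists (ap (e ^+ n) y), (x - ap (e ^+ n) y).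
  split; last by rewrite addrC subrK.
    by apply: mem_subim; exact: in_subT.
  by apply/in_subpre/in_sub0; rewrite linearB /= -ey subrr.
- by move=> x /in_subim[y _ ->] /in_subpre/in_sub0/kern.
- right; exists n; apply: ap_inj => x; apply: im0; apply: mem_subim.
  exact: in_subT.
left; apply: linear_bij.
  move=> x ex; apply: ker0; apply/in_subpre/in_sub0.
  by rewrite /n exprSr apM ex linear0.
move=> x; have [y ey] := imn x.
exists (ap (e ^+ (n1 + n2)) y).
rewrite -apM -exprS -/n; apply/eqP; rewrite -subr_eq0; apply/eqP.
by apply: ker0; apply/in_subpre/in_sub0; rewrite linearB /= -ey subrr.
Qed.

Lemma nilpotent_unit N (e : endo N) n : e ^+ n = 0 -> exists u, (1 - e) * u = 1.
Proof.
move=> en; exists (\sum_(i < n) e ^+ i); apply/oppr_inj.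
by rewrite -mulNr opprB -subrX1 en sub0r.
Qed.

End ArtinAlgebra.

(** * Projective ideals of the Auslander algebra *)

Section DualBasis.
Variables (R : pzRingType) (P : lmodType R).

Definition dual_basis : Prop :=
  exists (n : nat) (h : 'I_n -> P) (phi : 'I_n -> {linear P -> R^o}),
    forall x, x = \sum_i (phi i x : R) *: h i.

Lemma projective_dual_basis : finitely_generated P -> projective P -> dual_basis.
Proof.
move=> [n [v vP]] projP.
pose V := dsum (fun _ : 'I_n => R^o).
have sP (a : R) (u w : V) :
    \sum_i ((a *: u + w) i : R) *: v i =
    a *: (\sum_i (u i : R) *: v i) + \sum_i (w i : R) *: v i.
  rewrite scaler_sumr -big_split /=; apply: eq_bigr => i _.
  by rewrite scalerA -scalerDl.
have [|g gK] := projP V P (lin sP) [the {linear P -> P} of idfun].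
  by move=> y; have [a ->] := vP y; exists a.
exists n, v, (fun i => lcomp (dproj _ i) g) => x.
by rewrite -[LHS]gK.
Qed.

Lemma dual_basis_projective : dual_basis -> projective P.
Proof.
move=> [n [h [phi hphi]]] M N p f psurj.
have /choice[l lP] : forall i, exists y, p y = f (h i) by move=> i; exact: psurj.
have gP (a : R) (x y : P) :
    \sum_i (phi i (a *: x + y) : R) *: l i =
    a *: (\sum_i (phi i x : R) *: l i) + \sum_i (phi i y : R) *: l i.
  rewrite scaler_sumr -big_split /=; apply: eq_bigr => i _.
  by rewrite linearP scalerA -scalerDl.
exists (lin gP) => x; rewrite [in RHS](hphi x) /= !linear_sum.
by apply: eq_bigr => i _; rewrite !linearZ lP.
Qed.

End DualBasis.

Lemma linear_inverse (R : pzRingType) (M N : lmodType R) (f : {linear M -> N}) :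
  bijective f -> exists2 g : {linear N -> M}, cancel f g & cancel g f.
Proof.
move=> [g fK gK].
have gP (a : R) (x y : N) : g (a *: x + y) = a *: g x + g y.
  by apply: (can_inj fK); rewrite linearP !gK.
by exists (lin gP).
Qed.

Section Complement.
Variables (R : pzRingType) (N : lmodType R) (S T : submodClosed N).
Hypothesis STspan : forall x, exists s t, [/\ s \in S, t \in T & x = s + t].
Hypothesis STdirect : forall x, x \in S -> x \in T -> x = 0.

Lemma complement_proj : exists (p : {linear N -> submodule S})
    (q : {linear N -> submodule T}),
  [/\ forall x, x = val (p x) + val (q x), cancel val p & cancel val q].
Proof.
have h x : exists st : submodule S * submodule T, x = val st.1 + val st.2.
  have [s [t [sS tT e]]] := STspan x.
  by exists (Sub s sS, Sub t tT).
have [g gP] := choice h.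
have uniq (s s' : submodule S) (t t' : submodule T) :
    val s + val t = val s' + val t' -> s = s' /\ t = t'.
  move=> e; have d : val s - val s' = val t' - val t.
    by apply/eqP; rewrite subr_eq addrAC eq_sym subr_eq addrC -e addrC.
  have d0 : val s - val s' = 0.
    apply: STdirect; first exact: submodB (valP s) (valP s').
    by rewrite d; exact: submodB (valP t') (valP t).
  split; apply/val_inj/eqP; first by rewrite -subr_eq0 d0.
  by rewrite eq_sym -subr_eq0 -d d0.
have gL a x y : (g (a *: x + y)).1 = a *: (g x).1 + (g y).1 /\
    (g (a *: x + y)).2 = a *: (g x).2 + (g y).2.
  apply: uniq; rewrite -gP !linearP /= addrACA -scalerDr -!gP //.
exists (lin (fun a x y => (gL a x y).1)), (lin (fun a x y => (gL a x y).2)).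
split=> [x|s|t] /=; first exact: gP.
  by have [] := uniq (g (val s)).1 s (g (val s)).2 0; rewrite -?gP // linear0 addr0.
by have [] := uniq (g (val t)).1 0 (g (val t)).2 t; rewrite -?gP // linear0 add0r.
Qed.

End Complement.

Section Auslander.
Variables (A : pzRingType) (m : nat) (X : 'I_m -> rmodType A).
Hypotheses (hA : artin_algebra A) (hX : indecomposable_representatives X).
Implicit Types N : rmodType A.

Let M : rmodType A := dsum X.
Let B : pzRingType := endo M.

Lemma fgM : finitely_generated M.
Proof. by apply: fg_dsum => i; have [h _ _] := hX; have [] := h i. Qed.

(** For the identity of N this is a weak form of the Krull-Schmidt decomposition: the identity is a
    sum of idempotents with images isomorphic to some [X c], without a record of their
    orthogonality. *)
Inductive dec N : (N -> N) -> Prop :=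
| dec0 : dec (fun=> 0)
| decS (c : 'I_m) (p : {linear X c -> N}) (q : {linear N -> X c}) g :
    cancel p q -> dec g -> dec (fun x => p (q x) + g x).

Lemma decD N (f g : N -> N) : dec f -> dec g -> dec (fun x => f x + g x).
Proof.
move=> df dg; elim: df => [|c p q f' pK _ IH].
  by have -> : (fun x => 0 + g x) = g by apply/funext => x; rewrite add0r.
have -> : (fun x => p (q x) + f' x + g x) = (fun x => p (q x) + (f' x + g x)).
  by apply/funext => x; rewrite addrA.
exact: decS.
Qed.

Lemma dec_transport N N' (i : {linear N' -> N}) (pi : {linear N -> N'}) g :
  cancel i pi -> dec g -> dec (fun x => i (g (pi x))).
Proof.
move=> iK; elim=> [|c p q f pK _ IH].
  have -> : (fun _ : N => i 0) = (fun=> 0) by apply/funext => x; rewrite linear0.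
  exact: dec0.
have -> : (fun x => i (p (q (pi x)) + f (pi x))) =
    (fun x => lcomp i p (lcomp q pi x) + i (f (pi x))).
  by apply/funext => x; rewrite linearD.
by apply: decS => // x /=; rewrite iK.
Qed.

(** A decomposable N splits into two proper summands, to which the induction on length applies. *)
Lemma fg_dec N : finitely_generated N -> dec (fun x : N => x).
Proof.
move: N; apply: (strict_embedding_ind hA) => N fgN IH.
have [[x x0]|N0] := pselect (exists x : N, x != 0); last first.
  have -> : (fun x : N => x) = (fun=> 0); last exact: dec0.
  apply/funext => x; apply: contrapT => /eqP x0; apply: N0; by exists x.
have [ind|nind] := pselect (indecomposable N).
  have [_ /(_ N fgN ind)[c [f /linear_inverse[g fK gK]]] _] := hX.
  have -> : (fun x : N => x) = (fun x => g (f x) + 0).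
    by apply/funext => y; rewrite addr0 fK.
  by apply: decS => //; exact: dec0.
have [S [T [span dir [s sS s0] [t tT t0]]]] :
  exists S T : submodClosed N,
    [/\ forall x, exists s t, [/\ s \in S, t \in T & x = s + t],
        forall x, x \in S -> x \in T -> x = 0,
        exists2 s, s \in S & s != 0 & exists2 t, t \in T & t != 0].
  apply: contrapT => no; apply: nind; split; first by exists x.
  move=> S T span dir.
  have [S0|S0] := pselect (exists2 s, s \in S & s != 0); last first.
    left=> s sS; apply: contrapT => /eqP s0; apply: S0; by exists s.
  right=> t tT; apply: contrapT => /eqP t0; apply: no; exists S, T.
  by split=> //; exists t.
have [p [q [pq pK qK]]] := complement_proj span dir.
have -> : (fun x : N => x) = (fun x => val (p x) + val (q x)).
  by apply/funext => y; exact: pq.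
apply: decD.
- apply: (@dec_transport _ _ [the {linear submodule S -> N} of val] p (fun y => y) pK).
  apply: (IH _ [the {linear submodule S -> N} of val]).
  + exact: fg_sub.
  + exact: val_inj.
  + exists t => u; apply: contraNneq t0 => ut; apply/eqP.
    by apply: (dir t) => //; rewrite -ut; exact: valP.
- apply: (@dec_transport _ _ [the {linear submodule T -> N} of val] q (fun y => y) qK).
  apply: (IH _ [the {linear submodule T -> N} of val]).
  + exact: fg_sub.
  + exact: val_inj.
  + exists s => u; apply: contraNneq s0 => us; apply/eqP.
    by apply: (dir s) => //; rewrite -us; exact: valP.
Qed.

(** The form in which M acts as a generator (through the maps [p]) and as a cogenerator (through the
    maps [q]). *)
Lemma fg_add N : finitely_generated N ->
  exists (n : nat) (p : 'I_n -> {linear M -> N}) (q : 'I_n -> {linear N -> M}),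
    forall x, x = \sum_i p i (q i x).
Proof.
move=> /fg_dec decN.
have h g : dec g -> exists s : seq ({linear M -> N} * {linear N -> M}),
    forall x, g x = \sum_(e <- s) e.1 (e.2 x).
  elim=> [|c p q {}g _ _ [s sP]]; first by exists [::] => x; rewrite big_nil.
  exists ((lcomp p (dproj X c), lcomp (dinj X c) q) :: s) => x.
  by rewrite big_cons -sP; congr (p _ + _); symmetry; exact: dinjK.
have [s sP] := h _ decN.
exists (size s), (fun i => (tnth (in_tuple s) i).1), (fun i => (tnth (in_tuple s) i).2).
by move=> x; rewrite [LHS](sP x) big_tnth.
Qed.

(** The sum of the images of all composites b h with h in H, encoded as the intersection of the
    submodules that contain them. *)
Definition trace (H : ideal B) N : submodClosed N.
refine (@submod_of _ N (fun z => forall T : submodClosed N,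
  (forall (b : {linear M -> N}) h y, h \in H -> b (ap h y) \in T) -> z \in T) _ _).
  by move=> T _; exact: rpred0.
by move=> a x y hx hy T hT; rewrite rpredD ?rpredZ ?hx ?hy.
Defined.

Lemma mem_trace (H : ideal B) N (b : {linear M -> N}) h y :
  h \in H -> b (ap h y) \in trace H N.
Proof. by move=> hH; apply/in_submod_of => T; exact. Qed.

Lemma trace_sub (H : ideal B) N (T : submodClosed N) :
  (forall (b : {linear M -> N}) h y, h \in H -> b (ap h y) \in T) ->
  {subset trace H N <= T}.
Proof. by move=> hT x /in_submod_of; exact. Qed.

Lemma ideal_sum (H : ideal B) n (F : 'I_n -> B) :
  (forall i, F i \in H) -> \sum_i F i \in H.
Proof.
move=> FH; elim/big_ind: _ => //; first exact: ideal0.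
by move=> x y; exact: idealD.
Qed.

(** With a dual basis (h_j, phi_j) of H, write f x as the sum of the h_l u_l. The sums of the
    phi_j(h_l) u_l are then the values of endomorphisms g_j, and f is the sum of the h_j g_j. *)
Lemma right_projective_mem (H : ideal B) : projective (right_module H) ->
  forall f : B, (forall x, ap f x \in trace H M) -> f \in H.
Proof.
move=> /projective_dual_basis[|n [h [phi hphi]]].
  have [_ [b rb]] := artin_endo_ranked hA fgM; exact: ranked_fg_sub rb.
pose V := dsum (fun _ : 'I_n => M).
have sP (a : A^c) (u v : V) :
    \sum_l ap (val (h l)) ((a *: u + v) l) =
    a *: (\sum_l ap (val (h l)) (u l)) + \sum_l ap (val (h l)) (v l).
  rewrite scaler_sumr -big_split /=; apply: eq_bigr => l _.
  exact: (linearP (ap (val (h l)))).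
pose sumh : {linear V -> M} := lin sP.
(* The kernel K of [sumh] is a summand of a power of M, so [u] is a sum of values of maps from M to
   K. For such a map, with components a_l, the sum of the h_l a_l is 0 in H, and right linearity of
   phi_j applies. *)
have key j (u : V) : sumh u = 0 -> \sum_l ap (phi j (h l) : B) (u l) = 0.
  move=> u0; pose K := subpre sumh sub0.
  have uK : u \in K by apply/in_subpre/in_sub0.
  have /fg_add[n' [p [q pq]]] : finitely_generated (submodule K).
    by apply: fg_sub => //; apply: fg_dsum => _; exact: fgM.
  pose a i l : B := lcomp (dproj _ l) (lcomp [the {linear submodule K -> V} of val] (p i)).
  have a0 i : \sum_l (phi j (h l) : B) * a i l = 0.
    have e : \sum_l (a i l : B^c) *: h l = 0.
      apply: val_inj; rewrite linear_sum; apply: ap_inj => y.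
      rewrite ap_sum; have /in_subpre/in_sub0 := valP (p i y).
      by move=> e0; rewrite -[RHS]e0; apply: eq_bigr => l _.
    have := congr1 (phi j) e; rewrite linear_sum linear0 => e0.
    by rewrite -[RHS]e0; apply: eq_bigr => l _; rewrite linearZ.
  have eu l : u l = \sum_i ap (a i l) (q i (Sub u uK)).
    pose D := lcomp (dproj (fun _ : 'I_n => M) l)
      [the {linear submodule K -> V} of val].
    by have := congr1 D (pq (Sub u uK)); rewrite linear_sum.
  under eq_bigr => l _ do rewrite eu linear_sum.
  rewrite exchange_big big1 // => i _.
  have := congr1 (fun f => ap f (q i (Sub u uK))) (a0 i).
  by rewrite ap_sum.
move=> f fT.
(* Every g in H is the sum of the h_l phi_l(g), so the trace of H lies in the image of [sumh]. *)
have hV x : exists u : V, ap f x = sumh u.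
  have /(trace_sub (T := subim sumh subT)) : ap f x \in trace H M by [].
  move=> h1; have /h1/in_subim[u _ ->] : forall (b : {linear M -> M}) g y,
      g \in H -> b (ap g y) \in subim sumh subT; last by exists u.
  move=> b g y gH; pose g' : right_module H := Sub ((b : B) * g) (idealMl (b : B) gH).
  apply/in_subim; exists (fun l => ap (phi l g' : B) y); first exact: in_subT.
  have := congr1 val (hphi g'); rewrite linear_sum => /(congr1 (fun z => ap z (y))).
  by rewrite ap_sum.
have [U UP] := choice hV.
(* By [key] the value does not depend on the chosen preimage [U x], whence linearity. *)
have gP j (a : A^c) (x y : M) :
    \sum_l ap (phi j (h l) : B) (U (a *: x + y) l) =
    a *: (\sum_l ap (phi j (h l) : B) (U x l)) +
    \sum_l ap (phi j (h l) : B) (U y l).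
  have := key j (U (a *: x + y) - (a *: U x + U y)).
  rewrite linearB linearP -!UP linearP subrr => /(_ erefl) e.
  apply/eqP; rewrite -subr_eq0 -[X in _ == X]e scaler_sumr -big_split -sumrB.
  apply/eqP/eq_bigr => l _ /=.
  symmetry; have := linearB (ap (phi j (h l) : B)) (U (a *: x + y) l) (a *: U x l + U y l).
  by rewrite (linearP (ap (phi j (h l) : B)) a).
have -> : f = \sum_j (val (h j) : B) * (lin (gP j) : B).
  apply: ap_inj => x; rewrite UP ap_sum.
  rewrite (eq_bigr (fun j => \sum_l ap ((val (h j) : B) * (phi j (h l) : B)) (U x l))).
    rewrite exchange_big /=; apply: eq_bigr => l _.
    have := congr1 val (hphi (h l)); rewrite linear_sum => /(congr1 (fun z => ap z (U x l))).
    by rewrite ap_sum.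
  by move=> j _; rewrite apM linear_sum.
apply: ideal_sum => j; apply: idealMr; exact: (valP (h j)).
Qed.

(** Dual to the previous argument, with M as a cogenerator: f is the sum of the f Y_j h_j, where
    Y_j(x) is any y with h_l y = phi_j(h_l) x for all l. *)
Lemma left_projective_mem (H : ideal B) : projective (left_module H) ->
  forall f : B, (forall x, (forall h, h \in H -> ap h x = 0) -> ap f x = 0) ->
  f \in H.
Proof.
move=> /projective_dual_basis[|n [h [phi hphi]]].
  have [[b rb] _] := artin_endo_ranked hA fgM; exact: ranked_fg_sub rb.
pose V := dsum (fun _ : 'I_n => M).
have sP (a : A^c) (x y : M) :
    (fun l => ap (val (h l)) (a *: x + y)) =
    a *: ((fun l => ap (val (h l)) x) : V) + (fun l => ap (val (h l)) y) :> V.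
  apply: functional_extensionality_dep => l; exact: (linearP (ap (val (h l)))).
pose hmap : {linear M -> V} := lin sP.
(* The cokernel Q of [hmap] is a summand of a power of M, so the vector [w] vanishes in Q once every
   map from Q to M kills it. Such a map has components a_l with the sum of the a_l h_l equal to 0,
   and left linearity of phi_j applies. *)
have key j x : exists y, forall l, ap (val (h l)) y = ap (phi j (h l) : B) x.
  pose w : V := fun l => ap (phi j (h l) : B) x.
  pose Q := quot_mod (subim hmap subT).
  suff /qmap_eq0/in_subim[y _ ey] : qmap (subim hmap subT) w = 0.
    by exists y => l; exact/esym/(congr1 (fun u : V => u l) ey).
  have /fg_add[n' [p [q pq]]] : finitely_generated Q.
    apply: (fg_surj (@qmap_surj _ _ (subim hmap subT))).
    by apply: fg_dsum => _; exact: fgM.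
  rewrite [LHS]pq big1 // => i _.
  pose a l : B := lcomp (q i) (lcomp (qmap (subim hmap subT)) (dinj (fun _ : 'I_n => M) l)).
  have qE (u : V) : q i (qmap (subim hmap subT) u) = \sum_l ap (a l) (u l).
    by rewrite [in LHS](dsum_decomp u) !linear_sum.
  have a0 : \sum_l a l * (phi j (h l) : B) = 0.
    have e : \sum_l (a l : B) *: h l = 0.
      apply: val_inj; rewrite linear_sum; apply: ap_inj => y.
      rewrite ap_sum -[RHS](linear0 (q i)).
      have e0 : qmap (subim hmap subT) (hmap y) = 0.
        by apply/qmap_eq0; apply: mem_subim; exact: in_subT.
      by rewrite -[in RHS]e0 qE; apply: eq_bigr => l _.
    have := congr1 (phi j) e; rewrite linear_sum linear0 => e0.
    by rewrite -[RHS]e0; apply: eq_bigr => l _; rewrite linearZ.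
  rewrite qE.
  have := congr1 (fun f => ap f x) a0; rewrite ap_sum /= => e0.
  by rewrite (eq_bigr (fun l => ap (a l * (phi j (h l) : B)) x)) // e0 linear0.
move=> f fK.
have /choice[Y YP] : forall jx : 'I_n * M, exists y,
    forall l, ap (val (h l)) y = ap (phi jx.1 (h l) : B) jx.2.
  by move=> [j x]; exact: key.
(* The h_l generate H, so their common kernel is that of H, on which f vanishes. *)
have feq x y : (forall l, ap (val (h l)) x = ap (val (h l)) y) -> ap f x = ap f y.
  move=> exy; apply/eqP; rewrite -subr_eq0 -linearB; apply/eqP/fK => g gH.
  pose g' : left_module H := Sub g gH.
  have := congr1 val (hphi g'); rewrite linear_sum => /(congr1 (fun z => ap z (x - y))).
  rewrite ap_sum /= => ->; apply: big1 => l _.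
  by rewrite -[LHS]/(ap (phi l g' : B) (ap (val (h l)) (x - y))) linearB exy subrr linear0.
have gP j (a : A^c) (x y : M) :
    ap f (Y (j, a *: x + y)) = a *: ap f (Y (j, x)) + ap f (Y (j, y)).
  by rewrite -linearP; apply: feq => l; rewrite linearP !YP linearP.
have -> : f = \sum_j (lin (gP j) : B) * (val (h j) : B).
  apply: ap_inj => x; rewrite ap_sum.
  rewrite (eq_bigr (fun j => ap f (Y (j, ap (val (h j)) x)))) // -linear_sum.
  apply: feq => l; rewrite linear_sum.
  rewrite (eq_bigr (fun j => ap (phi j (h l) : B) (ap (val (h j)) x))); last first.
    by move=> j _; rewrite YP.
  have := congr1 val (hphi (h l)); rewrite linear_sum => /(congr1 (fun z => ap z (x))).
  by rewrite ap_sum.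
apply: ideal_sum => j; apply: idealMl; exact: (valP (h j)).
Qed.

End Auslander.

(** * Factorization through an ideal of the endomorphism ring *)

Section Jacobson.
Variable R : pzRingType.
Implicit Types x y u : R.

Lemma quasiregular_jacobson x :
  (forall y, exists u, (1 - x * y) * u = 1) -> x \in @jacobson_radical R.
Proof.
move=> qr; apply/asboolP => S [S1 Smax]; apply: contrapT => /negP xS.
pose T := subD S (cyclic_sub (x : R^c^o)).
have xT : (x : R^c^o) \in T.
  by apply: subDr; apply/in_cyclic_sub; exists 1; rewrite scale1r.
have [/in_subD[s sS /in_cyclic_sub[y e]]|T1] := boolP ((1 : R^c^o) \in T); last first.
  by move/negP: xS; apply; apply: (Smax T) => //; exact: subDl.
have [u ue] := qr y; move/negP: S1; apply.
have es : s = 1 - x * y by rewrite -[x * y]e opprB addrC subrK.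
by have := rpredZ (u : R^c) sS; rewrite es [_ *: _]ue.
Qed.

Lemma jacobson_quasiregular x : x \in @jacobson_radical R ->
  forall y, exists u, (1 - x * y) * u = 1.
Proof.
move=> /asboolP xJ y; apply: contrapT => nu.
have [|W [sW W1] Wmax] :=
    @maximal_avoiding _ _ (cyclic_sub (1 - x * y : R^c^o)) (1 : R^c^o).
  by apply/negP => /in_cyclic_sub[u e]; apply: nu; exists u.
have maxW : maximal_right_ideal W.
  split=> // T WT T1 z zT; apply: contrapT => /negP/Wmax/in_subD[w wW].
  move=> /in_cyclic_sub[a e]; move/negP: T1; apply.
  suff : w + a *: z \in T by rewrite -e addrC subrK.
  by apply: rpredD; [exact: WT | exact: rpredZ].
have xW := xJ _ maxW; move/negP: W1; apply.
suff : (1 - x * y : R^c^o) + (y : R^c) *: (x : R^c^o) \in W.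
  by rewrite -[_ *: _]/(x * y) subrK.
apply: rpredD; last exact: rpredZ.
by apply: sW; apply/in_cyclic_sub; exists 1; rewrite scale1r.
Qed.

End Jacobson.

Lemma sandwich_mem (R : pzRingType) (H H' : ideal R) (h1 y h2 : R) :
    radical_sandwich_zero (quotient_ideal H' H) -> h1 \in H -> h2 \in H ->
    (forall z, exists u, (1 - y * z) * u = 1) -> h1 * y * h2 \in H'.
Proof.
move=> sand h1H h2H qr.
have proj0 : quotient_proj H' 0 = 0 by rewrite /quotient_proj raddf0.
suff e : quotient_proj H' (h1 * y * h2) = 0.
  have : h1 * y * h2 - 0 \in H' by apply/quotient_projP; rewrite e proj0.
  by rewrite subr0.
apply/eqP; rewrite -[_ == _]sand; apply/asboolP.
exists 1%N, (fun=> quotient_proj H' (h1 * y)), (fun=> quotient_proj H' h2).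
split=> [_|_|]; last by rewrite big_ord1 quotient_projM.
- apply/asboolP; exists 1%N, (fun=> quotient_proj H' h1), (fun=> quotient_proj H' y).
  split=> [_|_|]; last by rewrite big_ord1 quotient_projM.
  + by apply/asboolP; exists h1.
  + apply: quasiregular_jacobson => z'; have [z ->] := quotient_projS z'.
    have [u ue] := qr z; exists (quotient_proj H' u).
    rewrite -[_ * quotient_proj H' z]quotient_projM.
    have -> : 1 - quotient_proj H' (y * z) = quotient_proj H' (1 - y * z).
      by rewrite /quotient_proj raddfB.
    by rewrite -[LHS]quotient_projM ue.
- by apply/asboolP; exists h2.
Qed.

Section Factorization.
Variables (A : pzRingType) (m : nat) (X : 'I_m -> rmodType A).
Hypotheses (hA : artin_algebra A) (hX : indecomposable_representatives X).
Implicit Types N : rmodType A.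

Let M : rmodType A := dsum X.
Let B : pzRingType := endo M.
Implicit Type H : ideal B.

(** Sums of maps factoring through an element of H. On the identity of N it says that N is cut out
    of a power of M by elements of H. Bare functions allow rewriting by extensionality. *)
Inductive via H N N' : (N -> N') -> Prop :=
| via0 : via H (fun=> 0)
| viaS (a : {linear N -> M}) (h : B) (b : {linear M -> N'}) f :
    h \in H -> via H f -> via H (fun x => b (ap h (a x)) + f x).

Lemma via_sum H N N' n (a : 'I_n -> {linear N -> M}) (h : 'I_n -> B)
    (b : 'I_n -> {linear M -> N'}) :
  (forall i, h i \in H) -> via H (fun x => \sum_i b i (ap (h i) (a i x))).
Proof.
elim: n a h b => [|n IH] a h b hH.
  by under eq_fun do rewrite big_ord0; exact: via0.
under eq_fun do rewrite big_ord_recl.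
by apply: viaS => //; exact: IH.
Qed.

Lemma viaD H N N' (f g : N -> N') : via H f -> via H g -> via H (fun x => f x + g x).
Proof.
move=> vf vg; elim: vf => [|a h b {}f hH _ IH].
  by under eq_fun do rewrite add0r.
by under eq_fun do rewrite -addrA; exact: viaS.
Qed.

Lemma via_decomp H N N' (f : {linear N -> N'}) :
    finitely_generated N -> finitely_generated N' ->
    (forall (p : {linear M -> N}) (q : {linear N' -> M}),
      (lcomp q (lcomp f p) : B) \in H) -> via H f.
Proof.
move=> /(fg_add hA hX)[n [p [q pq]]] /(fg_add hA hX)[n' [p' [q' pq']]] fH.
have -> : f = (fun x => \sum_j \sum_i
    p' i (ap (lcomp (q' i) (lcomp f (p j)) : B) (q j x))) :> (N -> N').
  apply/funext => x; rewrite [in LHS](pq x) linear_sum.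
  by apply: eq_bigr => j _; rewrite [LHS]pq'.
elim: n p q {pq} => [|n IH] p q.
  by under eq_fun do rewrite big_ord0; exact: via0.
under eq_fun do rewrite big_ord_recl.
have v := via_sum (fun=> q ord0) p' (fun i => fH (p ord0) (q' i)).
exact: viaD v (IH (fun j => p (lift ord0 j)) (fun j => q (lift ord0 j))).
Qed.

Lemma via_trace H N N' (f : {linear N -> N'}) : projective (right_module H) ->
    finitely_generated N -> finitely_generated N' ->
    (forall x, f x \in trace H N') -> via H f.
Proof.
move=> projH fgN fgN' fT; apply: via_decomp => // p q.
apply: (right_projective_mem hA hX projH) => x.
suff sub : {subset trace H N' <= subpre q (trace H M)}.
  by have /sub/in_subpre := fT (p x).
apply: trace_sub => b h y hH.
by apply/in_subpre; exact: (mem_trace (lcomp q b)).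
Qed.

(** Together with [via_trace] this transports the two membership criteria from M to all finitely
    generated modules; [via_in_trace] and [via_kills] are the converses. *)
Lemma via_kernel H N N' (f : {linear N -> N'}) : projective (left_module H) ->
    finitely_generated N -> finitely_generated N' ->
    (forall x, (forall (a : {linear N -> M}) h, h \in H -> ap h (a x) = 0) ->
       f x = 0) -> via H f.
Proof.
move=> projH fgN fgN' fK; apply: via_decomp => // p q.
apply: (left_projective_mem hA hX projH) => x xK.
rewrite /= fK ?linear0 // => a h hH.
exact: (xK (h * (lcomp a p : B))) (idealMr _ hH).
Qed.

Lemma via_in_trace H N N' (f : N -> N') x : via H f -> f x \in trace H N'.
Proof.
elim=> [|a h b {}f hH _ IH]; first exact: rpred0.
by rewrite rpredD //; exact: mem_trace.
Qed.

Lemma via_kills H N N' (f : N -> N') x : via H f ->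
  (forall (a : {linear N -> M}) h, h \in H -> ap h (a x) = 0) -> f x = 0.
Proof.
move=> vf xK; elim: vf => [|a h b {}f hH _ IH] //.
by rewrite IH xK // linear0 addr0.
Qed.

Lemma via_id_surj H N N' (p : {linear N -> N'}) : projective (right_module H) ->
    finitely_generated N -> (forall y, exists x, p x = y) ->
  via H (fun x : N => x) -> via H (fun x : N' => x).
Proof.
move=> projH fgN ps vN; have fgN' := fg_surj ps fgN.
apply: (via_trace (f := [the {linear N' -> N'} of idfun])) => // y /=.
suff sub : {subset trace H N <= subpre p (trace H N')}.
  by have [x <-] := ps y; have /sub/in_subpre := via_in_trace x vN.
apply: trace_sub => b g z gH.
by apply/in_subpre; exact: (mem_trace (lcomp p b)).
Qed.

Lemma via_id_inj H N N' (i : {linear N' -> N}) : projective (left_module H) ->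
    finitely_generated N' -> injective i ->
  via H (fun x : N => x) -> via H (fun x : N' => x).
Proof.
move=> projH fgN' iinj vN.
apply: (via_kernel (f := [the {linear N' -> N'} of idfun])) => // x /= xK.
apply: iinj; rewrite linear0; apply: (via_kills vN) => a h hH.
exact: (xK (lcomp a i)).
Qed.

(** Writing f as id f id and expanding both identities through H produces middle terms h y h0 with y
    quasi-regular, which the radical condition places in H'. *)
Lemma sandwich_via H H' N N' (f : {linear N -> N'}) :
    radical_sandwich_zero (quotient_ideal H' H) ->
    via H (fun x : N => x) -> via H (fun x : N' => x) ->
    (forall (b : {linear M -> N}) (a : {linear N' -> M}) z, exists u,
       (1 - (lcomp a (lcomp f b) : B) * z) * u = 1) ->
  via H' f.
Proof.
move=> sand vN vN' qr.
have step b h (a : {linear N' -> M}) (g : N -> N) : h \in H -> via H g ->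
    via H' (fun x => (b : {linear M -> N'}) (ap h (a (f (g x))))).
  move=> hH; elim=> [|a0 h0 b0 {}g h0H _ IH].
    by under eq_fun do rewrite !linear0; exact: via0.
  under eq_fun do rewrite !linearD.
  apply: (@viaS H' N N' a0 (h * (lcomp a (lcomp f b0) : B) * h0) b _ _ IH).
  exact: sandwich_mem sand hH h0H (qr _ _).
suff : forall g : N' -> N', via H g -> via H' (fun x => g (f x)).
  by move=> h; exact: (h _ vN').
move=> g; elim=> [|a h b {}g hH _ IH]; first exact: via0.
exact: viaD (step b h a _ hH vN) IH.
Qed.

(** By Fitting's lemma al z be is nilpotent, so 1 - al z be has a right inverse u. Then 1 + be u al
    z is a right inverse of 1 - be al z. *)
Lemma quasiregular_comp N (al : {linear M -> N}) (be : {linear N -> M}) :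
    finitely_generated N -> indecomposable N ->
    (forall z : B, ~ bijective (lcomp al (lcomp (ap z) be))) ->
  forall z : B, exists u, (1 - (lcomp be al : B) * z) * u = 1.
Proof.
move=> fgN indN nb z.
pose e : endo N := lcomp al (lcomp (ap z) be).
have [/nb//|[n en]] := fitting hA e fgN indN.
have [u ue] := nilpotent_unit en.
pose v : B := lcomp be (lcomp (ap u) (lcomp al (ap z))).
exists (1 + v); apply: ap_inj => x; rewrite ap1 apM.
pose w : B := lcomp be (lcomp al (ap z)).
have -> : (lcomp be al : B) * z = w by apply: ap_inj.
rewrite apB ap1 apD ap1 [ap w (_ + _)]linearD.
have ev : ap v x = ap w x + ap w (ap v x).
  have := congr1 (fun g => ap g (al (ap z x))) ue.
  rewrite apM apB !ap1 => /eqP; rewrite subr_eq => /eqP h.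
  by rewrite -[LHS]/(be (ap u (al (ap z x)))) [in LHS]h linearD.
by rewrite -ev addrK.
Qed.

End Factorization.

(** * Hollow and uniform modules *)

Section UniserialCriterion.
Variables (R : pzRingType) (N : lmodType R).

Hypothesis hollow : forall S : submodClosed N,
  indecomposable (submodule S) -> forall T U : submodClosed (submodule S),
    (forall x, x \in subD T U) -> (forall x, x \in T) \/ (forall x, x \in U).
Hypothesis uniform : forall S T : submodClosed N,
  (forall x, x \in S -> x \in T -> x = 0) ->
  (forall x, x \in S -> x = 0) \/ (forall x, x \in T -> x = 0).

(** Uniformity makes a nonzero sum S + T indecomposable; being hollow, it equals S or T. *)
Lemma uniserial_criterion : uniserial N.
Proof.
move=> S T; pose D := subD S T.
pose v : {linear submodule D -> N} := [the {linear _ -> _} of val].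
have [[x x0]|D0] := pselect (exists x : submodule D, x != 0); last first.
  left=> x xS; have xD : x \in D by exact: subDl.
  have : (Sub x xD : submodule D) = 0.
    by apply: contrapT => /eqP x0; apply: D0; exists (Sub x xD).
  by move=> /(congr1 val) /= ->; exact: rpred0.
have ind : indecomposable (submodule D).
  split; first by exists x.
  move=> U W _ dir.
  have [|U0|W0] := @uniform (subim v U) (subim v W).
  - move=> y /in_subim[u uU ->] /in_subim[w wW /val_inj uw].
    by rewrite (dir u) ?linear0 // uw.
  - left=> u uU; apply: val_inj; rewrite linear0.
    by apply: U0; exact: (mem_subim v).
  - right=> u uW; apply: val_inj; rewrite linear0.
    by apply: W0; exact: (mem_subim v).
have [|allS|allT] := hollow ind (T := subpre v S) (U := subpre v T).
- move=> y; have /in_subD[s sS ysT] := valP y.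
  have sD : s \in D by exact: subDl.
  apply/in_subD; exists (Sub s sD); first exact/in_subpre.
  by apply/in_subpre; rewrite linearB.
- right=> t tT; have tD : t \in D by exact: subDr.
  by have /in_subpre := allS (Sub t tD).
- left=> s sS; have sD : s \in D by exact: subDl.
  by have /in_subpre := allT (Sub s sD).
Qed.

End UniserialCriterion.

(** * From a strongly heredity chain to uniserial modules *)

Section NakayamaNecessary.
Variables (A : pzRingType) (m : nat) (X : 'I_m -> rmodType A).
Hypotheses (hA : artin_algebra A) (hX : indecomposable_representatives X).
Let M : rmodType A := dsum X.
Let B : pzRingType := endo M.

Section Step.
Variables (H H' : ideal B) (N : rmodType A).
Hypotheses (fgN : finitely_generated N) (indN : indecomposable N).
Hypotheses (rH : projective (right_module H)) (lH : projective (left_module H)).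
Hypothesis sand : radical_sandwich_zero (quotient_ideal H' H).
Hypotheses (vN : via H (fun x : N => x)) (nvN : ~ via H' (fun x : N => x)).

(** An endomorphism of N whose image lies in a proper submodule is not bijective, so
    [quasiregular_comp] applies. Dually, in [projection_via] the endomorphisms kill a nonzero
    element. *)
Lemma inclusion_via (S : submodClosed N) : (exists x, x \notin S) ->
  via H' (val : submodule S -> N).
Proof.
move=> [x xS]; pose v : {linear submodule S -> N} := [the {linear _ -> _} of val].
have fgS := fg_sub hA S fgN.
apply: (sandwich_via (f := v) sand _ vN).
  exact: (@via_id_inj _ _ _ hA hX _ _ _ v lH fgS val_inj vN).
move=> b a; apply: (quasiregular_comp hA (al := lcomp v b)) => // z [g _ gK].
by move/negP: xS; apply; rewrite -(gK x); exact: valP.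
Qed.

Lemma projection_via (S : submodClosed N) : (exists2 x, x \in S & x != 0) ->
  via H' (qmap S).
Proof.
move=> [x xS x0]; have fgQ := fg_surj (@qmap_surj _ _ S) fgN.
apply: (sandwich_via sand vN).
  exact: (via_id_surj hA hX rH fgN (@qmap_surj _ _ S) vN).
move=> b a z.
have -> : (lcomp a (lcomp (qmap S) b) : B) = lcomp (lcomp a (qmap S)) b.
  exact: linear_ext.
apply: (quasiregular_comp hA (al := b)) => // {}z [g gK _].
have qx : qmap S x = 0 by apply/qmap_eq0.
move/eqP: x0; apply; rewrite -(gK x) -[in RHS](gK 0); congr (g _).
by rewrite /= -[qproj _ x]/(qmap S x) -[qproj _ 0]/(qmap S 0) qx !linear0.
Qed.

Hypotheses (rH' : projective (right_module H')) (lH' : projective (left_module H')).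

(** If both submodules were proper, the trace of H' would contain S and T, hence N, and the identity
    of N would factor through H'. *)
Lemma step_hollow (S T : submodClosed N) : (forall x, x \in subD S T) ->
  (forall x, x \in S) \/ (forall x, x \in T).
Proof.
move=> ST; apply: contrapT => no; apply: nvN.
have vS : via H' (val : submodule S -> N).
  apply: inclusion_via; apply: contrapT => nx; apply: no; left=> x.
  by apply: contrapT => /negP xS; apply: nx; exists x.
have vT : via H' (val : submodule T -> N).
  apply: inclusion_via; apply: contrapT => nx; apply: no; right=> x.
  by apply: contrapT => /negP xT; apply: nx; exists x.
apply: (via_trace hA hX (f := [the {linear N -> N} of idfun])) => // x /=.
have /in_subD[s sS xsT] := ST x.
suff : x - s + s \in trace H' N by rewrite subrK.
apply: rpredD.
  by have := via_in_trace (Sub (x - s) xsT : submodule T) vT; rewrite SubK.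
by have := via_in_trace (Sub s sS : submodule S) vS; rewrite SubK.
Qed.

(** If both were nonzero, an element of N killed by all maps through H' would lie in S and in T,
    hence be 0, and the identity of N would factor through H'. *)
Lemma step_uniform (S T : submodClosed N) :
  (forall x, x \in S -> x \in T -> x = 0) ->
  (forall x, x \in S -> x = 0) \/ (forall x, x \in T -> x = 0).
Proof.
move=> ST; apply: contrapT => no; apply: nvN.
have vS : via H' (qmap S).
  apply: projection_via; apply: contrapT => nx; apply: no; left=> x xS.
  by apply: contrapT => /eqP x0; apply: nx; exists x.
have vT : via H' (qmap T).
  apply: projection_via; apply: contrapT => nx; apply: no; right=> x xT.
  by apply: contrapT => /eqP x0; apply: nx; exists x.
apply: (via_kernel hA hX (f := [the {linear N -> N} of idfun])) => // x xK /=.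
by apply: ST; apply/qmap_eq0; [exact: via_kills vS xK | exact: via_kills vT xK].
Qed.

End Step.

Lemma strongly_quasi_hereditary_nakayama :
  strongly_quasi_hereditary (auslander_algebra X) -> nakayama A.
Proof.
move=> [n [H [_ [[H0 Hn _ _] rH] [_ lH]]]].
(* The chain gives this for i < n; the case i = n is the zero ideal, reached when the next ideal of
   the last step is needed. *)
have rP i : (i <= n)%N -> projective (right_module (H i)).
  rewrite leq_eqVlt => /orP[/eqP ->|/rH[]//].
  move=> P Q p f ps.
  have z0 (x : right_module (H n)) : x = 0.
    apply: val_inj; apply/eqP; rewrite linear0.
    by have := valP x; rewrite [_ \in _]Hn.
  have gP (a : (auslander_algebra X)^c) (x y : right_module (H n)) :
      (0 : P) = a *: 0 + 0 by rewrite scaler0 addr0.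
  by exists (lin gP) => x; rewrite [x]z0 !linear0.
have lP i : (i <= n)%N -> projective (left_module (H i)).
  rewrite leq_eqVlt => /orP[/eqP ->|/lH[]//].
  move=> P Q p f ps.
  have z0 (x : left_module (H n)) : x = 0.
    apply: val_inj; apply/eqP; rewrite linear0.
    by have := valP x; rewrite [_ \in _]Hn.
  have gP (a : auslander_algebra X) (x y : left_module (H n)) :
      (0 : P) = a *: 0 + 0 by rewrite scaler0 addr0.
  by exists (lin gP) => x; rewrite [x]z0 !linear0.
have level N : finitely_generated N -> indecomposable N ->
    exists2 i, (i < n)%N & via (H i) (fun x : N => x) /\ ~ via (H i.+1) (fun x : N => x).
  move=> fgN [[x x0] _].
  have v0 : via (H 0%N) (fun x : N => x).
    apply: (via_decomp hA hX (f := [the {linear N -> N} of idfun])) => // p q.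
    by rewrite H0.
  have vn : ~ via (H n) (fun x : N => x).
    move=> vn; move/eqP: x0; apply; apply: (via_kills vn) => a h.
    by rewrite Hn => /eqP ->.
  (* The level of N is the index just before the first ideal through which its identity fails to
     factor. *)
  have [|[|i] vi mini] := @ex_min_nat (fun i => ~ via (H i) (fun x : N => x)).
  - by exists n.
  - by case: vi.
  - exists i; first by apply: mini.
    by split=> //; apply: contrapT => /mini; rewrite ltnn.
have hollow (N : rmodType A) : finitely_generated N -> indecomposable N ->
    forall S T : submodClosed N, (forall x, x \in subD S T) ->
    (forall x, x \in S) \/ (forall x, x \in T).
  move=> fgN indN; have [i lt [vi nvi]] := level N fgN indN.
  have [_ sand] := rH i lt.
  exact: (step_hollow fgN indN (lP _ (ltnW lt)) sand vi nvi (rP _ lt)).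
move=> N fgN indN; apply: uniserial_criterion.
- move=> S indS; apply: hollow indS; exact: fg_sub.
- have [i lt [vi nvi]] := level N fgN indN; have [_ sand] := rH i lt.
  exact: (step_uniform fgN indN (rP _ (ltnW lt)) sand vi nvi (lP _ lt)).
Qed.

End NakayamaNecessary.

(** * Idempotent ideals attached to annihilators *)

Section QuotientHeredity.
Variables (R : pzRingType) (H H' : ideal R).
Hypothesis sH : {subset H' <= H}.
Hypothesis idemH : idempotent_ideal H.
Hypothesis idemH' : idempotent_ideal H'.

Let Rq := quotient_ring H'.

Lemma quotient_proj0 x : quotient_proj H' x = 0 <-> x \in H'.
Proof.
have <- : quotient_proj H' 0 = 0 by rewrite /quotient_proj raddf0.
by split=> [/quotient_projP|xH]; [|apply/quotient_projP]; rewrite subr0.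
Qed.

Lemma ideal_product_sub (S : pzRingType) (I : ideal S) :
  {subset ideal_product I I <= I}.
Proof.
move=> x /asboolP[n [a [b [aI bI ->]]]]; elim/big_ind: _ => //.
- exact: ideal0.
- by move=> y z; exact: idealD.
- by move=> i _; apply: idealMr.
Qed.

Lemma quotient_idempotent : idempotent_ideal (quotient_ideal H' H).
Proof.
move=> y; apply/idP/idP; first exact: ideal_product_sub.
move=> /asboolP[x]; rewrite -idemH => /asboolP[n [a [b [aH bH ->]]]] ->.
apply/asboolP; exists n, (fun i => quotient_proj H' (a i)),
  (fun i => quotient_proj H' (b i)); split=> [i|i|].
- by apply/asboolP; exists (a i).
- by apply/asboolP; exists (b i).
- by rewrite /quotient_proj raddf_sum; apply: eq_bigr => i _; exact: quotient_projM.
Qed.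

Let phiB (x y : R^c) : (quotient_proj H' (x - y) : Rq^c) =
  (quotient_proj H' x : Rq^c) - quotient_proj H' y.
Proof. by rewrite /quotient_proj raddfB. Qed.
Let phiM (x y : R^c) : (quotient_proj H' (x * y) : Rq^c) =
  (quotient_proj H' x : Rq^c) * quotient_proj H' y.
Proof. exact: quotient_projM. Qed.
Let phi : {rmorphism R^c -> Rq^c} := @rmorph_of R^c Rq^c (quotient_proj H')
  phiB erefl phiM.

(** A lift of f along H, with values in a module over the quotient ring, kills H' = H' H' because H'
    acts as zero there; it therefore descends to H / H'. *)
Lemma quotient_projective : projective (right_module H) ->
  projective (right_module (quotient_ideal H' H)).
Proof.
move=> projH P Q p f psurj.
pose D := right_module (quotient_ideal H' H).
have memq (h : right_module H) : quotient_proj H' (val h) \in quotient_ideal H' H.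
  by apply/asboolP; exists (val h) => //; exact: (valP h).
pose c (h : right_module H) : D := Sub (quotient_proj H' (val h)) (memq h).
have f'P (a : R^c) (x y : right_module H) :
    (f (c (a *: x + y)) : restrict phi Q) = a *: (f (c x) : restrict phi Q) + f (c y).
  rewrite restrict_scaleE -linearP; congr (f _); apply: val_inj.
  by rewrite linearP /= quotient_projD quotient_projM.
have p'P (a : R^c) (x y : restrict phi P) :
    (p (a *: x + y : restrict phi P) : restrict phi Q) =
    a *: (p x : restrict phi Q) + p y.
  by rewrite -[LHS]/(p (phi a *: (x : P) + y)) linearP.
have [|g gP] := projH _ _ (@lin _ (restrict phi P) (restrict phi Q) _ p'P)
  (@lin _ _ (restrict phi Q) _ f'P).
  exact: psurj.
have g0 (h : right_module H) : val h \in H' -> g h = 0.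
  rewrite -idemH' => /asboolP[n [a [b [aH bH e]]]].
  pose a' i : right_module H := Sub (a i) (sH (aH i)).
  have -> : h = \sum_i (b i : R^c) *: a' i by apply: val_inj; rewrite linear_sum.
  rewrite linear_sum big1 // => i _; rewrite linearZ.
  rewrite -[LHS]/((quotient_proj H' (b i) : Rq^c) *: (g (a' i) : P)).
  have -> : quotient_proj H' (b i) = 0 :> Rq^c by apply/quotient_proj0; exact: bH.
  by rewrite scale0r.
have /choice[r rP] : forall u : D, exists h : right_module H,
    val u = quotient_proj H' (val h).
  move=> u; have /asboolP[x xH e] := valP u.
  by exists (Sub x xH).
have geq x y : quotient_proj H' (val x) = quotient_proj H' (val y) -> g x = g y.
  move=> e; apply/eqP; rewrite -subr_eq0 -linearB; apply/eqP/g0.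
  by rewrite linearB; apply/quotient_projP.
have gL (a : Rq^c) (x y : D) : (g (r (a *: x + y)) : P) = a *: (g (r x) : P) + g (r y).
  have [a' ea] := quotient_projS (a : Rq).
  have -> : a *: (g (r x) : P) + g (r y) = g ((a' : R^c) *: r x + r y).
    by rewrite [RHS]linearP restrict_scaleE ea.
  apply: geq; rewrite -rP !linearP /= !rP quotient_projD quotient_projM ea.
  by [].
exists (lin gL) => u; rewrite -[LHS]/(p (g (r u))).
have := gP (r u); rewrite /= => ->; congr (f _); apply: val_inj.
by rewrite /= -rP.
Qed.

Lemma quotient_heredity : projective (right_module H) ->
  radical_sandwich_zero (quotient_ideal H' H) ->
  heredity_ideal (quotient_ideal H' H).
Proof.
move=> projH sand; split=> //; first exact: quotient_idempotent.
exact: quotient_projective.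
Qed.

Lemma sandwich_zero :
    (forall h1 y h2, h1 \in H -> h2 \in H ->
      quotient_proj H' y \in @jacobson_radical Rq -> h1 * y * h2 \in H') ->
  radical_sandwich_zero (quotient_ideal H' H).
Proof.
move=> hyh y; apply/idP/idP; last first.
  move=> /eqP ->; apply/asboolP; exists 0%N, (fun=> 0), (fun=> 0).
  by split=> [[]|[]|]; rewrite ?big_ord0.
move=> /asboolP[n [u [v [uP vP ->]]]]; apply/eqP; apply: big1 => i _.
have /asboolP[h2 h2H ->] := vP i.
have /asboolP[n' [a [b [aP bP ->]]]] := uP i.
rewrite mulr_suml big1 // => j _; have /asboolP[h1 h1H ea] := aP j.
have [z ez] := quotient_projS (b j); have := bP j; rewrite ea ez => zJ.
have /quotient_proj0 := hyh h1 z h2 h1H h2H zJ.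
by rewrite !quotient_projM.
Qed.

End QuotientHeredity.

Definition corestrict (R : pzRingType) (N N' : lmodType R) (K : submodClosed N')
    (f : {linear N -> N'}) (fK : forall x, f x \in K) : {linear N -> submodule K}.
refine (@lin R N (submodule K) (fun x => Sub (f x) (fK x)) _) => a x y.
by apply: val_inj; exact: (linearP f).
Defined.

Section AnnihilatorIdeal.
Variables (A : pzRingType) (m : nat) (X : 'I_m -> rmodType A).
Hypotheses (hA : artin_algebra A) (hX : indecomposable_representatives X).
Implicit Types N : rmodType A.

Let M : rmodType A := dsum X.
Let B : pzRingType := endo M.

Variable U : 'I_m -> Prop.

Definition annih (a : A^c) : Prop := forall c, U c -> forall y : X c, a *: y = 0.

(** Not the classical socle, but the largest submodule of N killed by [annih]. *)
Definition socle N : submodClosed N.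
refine (@submod_of _ N (fun x => forall a, annih a -> a *: x = 0) _ _).
  by move=> a _; rewrite scaler0.
move=> b x y hx hy a Ia; rewrite scalerDr hy // addr0 scalerA.
by apply: hx => c Uc z; rewrite -scalerA Ia.
Defined.

Definition annih_pred : {pred B} :=
  fun f => `[< forall x, ap f x \in socle M >].

Fact annih_ideal0 : 0 \in annih_pred.
Proof. by apply/asboolP => x; exact: rpred0. Qed.
Fact annih_idealD : {in annih_pred &, forall f g, f + g \in annih_pred}.
Proof.
move=> f g /asboolP hf /asboolP hg; apply/asboolP => x.
by apply: rpredD; [exact: hf | exact: hg].
Qed.
Fact annih_idealMl b : {in annih_pred, forall f, b * f \in annih_pred}.
Proof.
move=> f /asboolP hf; apply/asboolP => x; apply/in_submod_of => a Ia.
by have /in_submod_of/(_ a Ia) e := hf x; rewrite apM -linearZ e linear0.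
Qed.
Fact annih_idealMr b : {in annih_pred, forall f, f * b \in annih_pred}.
Proof. by move=> f /asboolP hf; apply/asboolP => x; rewrite apM. Qed.

Definition annih_ideal : ideal B :=
  Ideal annih_ideal0 annih_idealD annih_idealMl annih_idealMr.

Lemma in_annih_ideal f : f \in annih_ideal <->
  forall x a, annih a -> a *: ap f x = 0.
Proof.
split=> [/asboolP h x|h]; first by have /in_submod_of := h x.
by apply/asboolP => x; apply/in_submod_of; exact: h.
Qed.

Lemma annih_ideal_socle f : f \in annih_ideal -> forall x, ap f x \in socle M.
Proof. by move=> /asboolP. Qed.

Let fgM := fgM hX.

(** The ideal is Hom(M, [socle M]), and writing [socle M] as a summand of a power of M gives a dual
    basis. *)
Lemma annih_right_projective : projective (right_module annih_ideal).
Proof.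
apply: dual_basis_projective.
have /(fg_add hA hX)[n [p [q pq]]] : finitely_generated (submodule (socle M)).
  exact: fg_sub.
pose v : {linear submodule (socle M) -> M} := [the {linear _ -> _} of val].
have hI j : (lcomp v (p j) : B) \in annih_ideal.
  by apply/asboolP => x; exact: (valP (p j x)).
pose co (f : right_module annih_ideal) := corestrict (annih_ideal_socle (valP f)).
have phiP j (a : B^c) (f g : right_module annih_ideal) :
    (lcomp (q j) (co (a *: f + g)) : B^c^o) =
    a *: (lcomp (q j) (co f) : B^c^o) + (lcomp (q j) (co g) : B).
  apply: (@ap_inj _ _ (lcomp (q j) (co (a *: f + g)))) => x.
  rewrite -[RHS]/(q j (co f (ap (a : B) x)) + q j (co g x)) -linearD.
  by congr (q j _); apply: val_inj.
exists n, (fun j => Sub (lcomp v (p j) : B) (hI j)), (fun j => lin (phiP j)) => f.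
apply: val_inj; rewrite linear_sum; apply: ap_inj => x; rewrite ap_sum.
by have := congr1 v (pq (co f x)); rewrite linear_sum.
Qed.

(** The ideal is also Hom(Q, M), with Q the quotient of M by the common kernel of the ideal:
    elements of [annih] carry M into that kernel, so every map from Q to M lies in the ideal once
    composed with the projection. *)
Lemma annih_left_projective : projective (left_module annih_ideal).
Proof.
apply: dual_basis_projective.
have K0 : forall h, h \in annih_ideal -> ap h 0 = 0.
  by move=> h _; rewrite linear0.
have KL (a : A^c) (x y : M) : (forall h, h \in annih_ideal -> ap h x = 0) ->
    (forall h, h \in annih_ideal -> ap h y = 0) ->
    forall h, h \in annih_ideal -> ap h (a *: x + y) = 0.
  by move=> hx hy h hI; rewrite linearP hx ?hy // scaler0 addr0.
pose K := submod_of K0 KL; pose Q := quot_mod K.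
have /(fg_add hA hX)[n [p [q pq]]] : finitely_generated Q.
  exact: (fg_surj (@qmap_surj _ _ K)).
have hI j : (lcomp (q j) (qmap K) : B) \in annih_ideal.
  apply/in_annih_ideal => x a Ia; rewrite -linearZ /=.
  suff -> : qproj K (a *: x) = 0 by rewrite linear0.
  apply/qmap_eq0/in_submod_of => h /in_annih_ideal hI.
  by rewrite linearZZ; exact: hI.
have kill (f : left_module annih_ideal) x : x \in K -> ap (val f) x = 0.
  by move=> /in_submod_of; apply; exact: (valP f).
pose fa (f : left_module annih_ideal) : {linear Q -> M} := qfactor (kill f).
have phiP j (a : B) (f g : left_module annih_ideal) :
    (lcomp (fa (a *: f + g)) (p j) : B^o) =
    a *: (lcomp (fa f) (p j) : B^o) + (lcomp (fa g) (p j) : B).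
  exact: (@ap_inj _ _ (lcomp (fa (a *: f + g)) (p j))).
exists n, (fun j => Sub (lcomp (q j) (qmap K) : B) (hI j)), (fun j => lin (phiP j)) => f.
apply: val_inj; rewrite linear_sum; apply: ap_inj => x; rewrite ap_sum.
rewrite -[LHS](qfactorE (kill f)) [in LHS](pq (qmap K x)) linear_sum.
by [].
Qed.

(** Factor f through [socle M], a summand of a power of M; both halves have images killed by
    [annih]. *)
Lemma annih_idempotent : idempotent_ideal annih_ideal.
Proof.
move=> f; apply/idP/idP; first exact: ideal_product_sub.
move=> fI; have fS := annih_ideal_socle fI.
have /(fg_add hA hX)[n [p [q pq]]] : finitely_generated (submodule (socle M)).
  exact: fg_sub.
pose v : {linear submodule (socle M) -> M} := [the {linear _ -> _} of val].
apply/asboolP; exists n, (fun j => lcomp v (p j) : B),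
  (fun j => lcomp (q j) (corestrict fS) : B); split=> [j|j|].
- by apply/asboolP => x; exact: (valP (p j x)).
- apply/in_annih_ideal => x a Ia; rewrite -linearZ /=.
  have -> : Sub (f (a *: x)) (fS (a *: x)) = 0 :> submodule (socle M).
    apply: val_inj; rewrite -[LHS]/(ap f (a *: x)) linearZZ.
    by have /in_submod_of/(_ a Ia) := fS x.
  by rewrite linear0.
- apply: ap_inj => x; rewrite ap_sum.
  by have := congr1 v (pq (corestrict fS x)); rewrite linear_sum.
Qed.

End AnnihilatorIdeal.

(** * Nakayama algebras *)

Lemma uniserial_sub_indecomposable (R : pzRingType) (N : lmodType R)
    (S : submodClosed N) :
  uniserial N -> (exists2 x, x \in S & x != 0) -> indecomposable (submodule S).
Proof.
move=> uN [x xS x0].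
pose v : {linear submodule S -> N} := [the {linear _ -> _} of val].
split; first by exists (Sub x xS); apply: contraNneq x0 => /(congr1 v) /= ->.
move=> T W _ dir; have [TW|WT] := uN (subim v T) (subim v W).
- left=> t tT; apply: (dir t tT).
  by have /in_subim[w wW /val_inj ->] := TW _ (mem_subim v tT).
- right=> w wW; apply: (dir w) => //.
  by have /in_subim[t tT /val_inj ->] := WT _ (mem_subim v wW).
Qed.

Lemma uniserial_cyclic (R : pzRingType) (N : lmodType R) :
  uniserial N -> finitely_generated N ->
  exists x : N, forall y, exists a, y = a *: x.
Proof.
move=> uN [n [v vP]].
have [x xP] : exists x, forall i, v i \in cyclic_sub x.
  elim: n v {vP} => [|n IH] v; first by exists 0 => -[].
  have [x xP] := IH (fun i => v (lift ord0 i)).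
  have self y : y \in cyclic_sub y.
    by apply/in_cyclic_sub; exists 1; rewrite scale1r.
  have [h|h] := uN (cyclic_sub x) (cyclic_sub (v ord0)).
    by exists (v ord0) => i; case: (unliftP ord0 i) => [j ->|->]; [exact/h/xP | exact: self].
  by exists x => i; case: (unliftP ord0 i) => [j ->|->]; [exact: xP | exact/h/self].
exists x => y; apply/in_cyclic_sub; have [a ->] := vP y.
by apply: rpred_sum => i _; apply: rpredZ.
Qed.

(** * From uniserial modules to a strongly heredity chain *)

Section NakayamaSufficient.
Variables (A : pzRingType) (m : nat) (X : 'I_m -> rmodType A).
Hypotheses (hA : artin_algebra A) (hX : indecomposable_representatives X).
Hypothesis nak : nakayama A.
Implicit Types N D E : rmodType A.

Let M : rmodType A := dsum X.
Let B : pzRingType := endo M.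

Let fgX c : finitely_generated (X c).
Proof. by have [h _ _] := hX; have [] := h c. Qed.
Let indX c : indecomposable (X c).
Proof. by have [h _ _] := hX; have [] := h c. Qed.
Let repX N : finitely_generated N -> indecomposable N -> exists c, isomorphic N (X c).
Proof. by have [_ h _] := hX; exact: h. Qed.
Let uniqX c d : isomorphic (X c) (X d) -> c = d.
Proof. by have [_ _ h] := hX; exact: h. Qed.

Definition subquotient_closed (U : 'I_m -> Prop) : Prop :=
  (forall c d (f : {linear X d -> X c}), injective f -> U c -> U d) /\
  (forall c d (f : {linear X c -> X d}), (forall y, exists x, f x = y) -> U c -> U d).

Section Killed.
Variable U : 'I_m -> Prop.
Hypothesis Ucl : subquotient_closed U.

Let indec_subs_in D : Prop :=
  forall E (i : {linear E -> D}), finitely_generated E -> indecomposable E ->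
    injective i -> exists2 d, U d & isomorphic E (X d).

Let indec_subs_inX c : U c -> indec_subs_in (X c).
Proof.
move=> Uc E i fgE indE iinj; have [d [f fbij]] := repX fgE indE.
exists d; last by exists f.
have [g fK gK] := linear_inverse fbij.
by apply: (Ucl.1 _ _ (lcomp i g)) Uc; apply: inj_comp => //; exact: can_inj gK.
Qed.

(** On a uniserial submodule the kernels of the two components are comparable and meet in zero, so
    one component is injective. *)
Let indec_subs_in_prod D D' :
  indec_subs_in D -> indec_subs_in D' -> indec_subs_in (D * D')%type.
Proof.
move=> hD hD' E i fgE indE iinj.
have fP (a : A^c) (x y : E) : (i (a *: x + y)).1 = a *: (i x).1 + (i y).1.
  by rewrite linearP.
have gP (a : A^c) (x y : E) : (i (a *: x + y)).2 = a *: (i x).2 + (i y).2.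
  by rewrite linearP.
pose f := lin fP; pose g := lin gP.
have i0 x : f x = 0 -> g x = 0 -> x = 0.
  move=> fx gx; apply: iinj; rewrite linear0.
  by rewrite [i x]surjective_pairing -[(i x).1]/(f x) -[(i x).2]/(g x) fx gx.
have [fg|gf] := nak fgE indE (subpre f sub0) (subpre g sub0).
- apply: (hD E f) => //; apply: linear_inj => x fx; apply: i0 => //.
  by apply/in_sub0/in_subpre/fg/in_subpre/in_sub0.
- apply: (hD' E g) => //; apply: linear_inj => x gx; apply: i0 => //.
  by apply/in_sub0/in_subpre/gf/in_subpre/in_sub0.
Qed.

(** Take [xi] with minimal annihilator. Adjoining a coordinate y in some [X c] of U cannot shrink
    it, so whatever kills [xi] kills y. *)
Let annih_element : exists (D : rmodType A) (xi : D), indec_subs_in D /\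
  forall a : A^c, a *: xi = 0 -> annih X U a.
Proof.
have fgA : finitely_generated (A^c^o : rmodType A).
  exists 1%N, (fun=> 1) => x; exists (fun=> x); rewrite big_ord1.
  by rewrite -[RHS]/((x : A^c) * 1) mulr1.
have annP D (x : D) (a : A^c) (b c : A^c^o) :
    ((a *: b + c : A^c^o) : A^c) *: x = a *: ((b : A^c) *: x) + (c : A^c) *: x.
  by rewrite scalerDl scalerA.
pose ann D (x : D) : submodClosed A^c^o := subpre (lin (annP D x)) sub0.
have annE D (x : D) a : a \in ann D x <-> (a : A^c) *: x = 0.
  by split=> [/in_subpre/in_sub0|h]; [|apply/in_subpre/in_sub0].
have [b rb] := artin_fg_ranked hA fgA.
have [|T [_ [D [xi [tD eT]]] minT]] := ranked_min (P := fun T : submodClosed A^c^o =>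
    exists D (x : D), indec_subs_in D /\ T =i ann D x) rb.
  exists subT => //; exists (submodule (@sub0 _ M)), 0; split; last first.
    by move=> a; rewrite in_subT; symmetry; apply/annE; rewrite scaler0.
  move=> E i _ [[x x0] _] iinj; case/eqP: x0; apply: iinj; apply: val_inj.
  by rewrite !linear0; apply/in_sub0; exact: valP (i x).
exists D, xi; split=> // a axi c Uc y.
have /annE : a \in ann _ ((xi, y) : (D * X c)%type).
  apply: (minT (ann _ ((xi, y) : (D * X c)%type))).
  - exists (D * X c)%type, (xi, y); split=> //.
    by apply: indec_subs_in_prod => //; exact: indec_subs_inX.
  - by move=> b' /annE; rewrite eT => e; apply/annE; case: e.
  - by rewrite eT; apply/annE.
by case.
Qed.

(** N is generated by one element x, and sending [xi] to x is a surjection [th] onto N from the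
    cyclic module E on [xi]. As N is uniserial, one indecomposable summand of E already maps onto N;
    this summand embeds in D, so it and its quotient N belong to U. *)
Lemma killed_type N : finitely_generated N -> indecomposable N ->
    (forall a : A^c, annih X U a -> forall x : N, a *: x = 0) ->
  exists2 d, U d & isomorphic N (X d).
Proof.
move=> fgN indN killN; have uN := nak fgN indN.
have [D [xi [tD annxi]]] := annih_element.
have [x xP] := uniserial_cyclic uN fgN.
pose E := submodule (cyclic_sub xi).
have memE (a : A^c) : a *: xi \in cyclic_sub xi by apply/in_cyclic_sub; exists a.
have fgE : finitely_generated E.
  exists 1%N, (fun=> Sub (1 *: xi) (memE 1)) => -[y yE].
  have /in_cyclic_sub[a ey] : y \in cyclic_sub xi by [].
  exists (fun=> a); rewrite big_ord1; apply: val_inj.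
  by rewrite linearZ /= scale1r.
have /choice[r rP] : forall e : E, exists a : A^c, val e = a *: xi.
  by move=> e; exact/in_cyclic_sub/(valP e).
have same (a b : A^c) : a *: xi = b *: xi -> a *: x = b *: x.
  move=> /eqP; rewrite -subr_eq0 -scalerBl => /eqP/annxi ab.
  by apply/eqP; rewrite -subr_eq0 -scalerBl killN.
have thP (a : A^c) (e e' : E) : r (a *: e + e') *: x = a *: (r e *: x) + r e' *: x.
  rewrite scalerA -scalerDl; apply: same.
  by rewrite -rP linearP /= !rP scalerDl scalerA.
pose th := lin thP.
have th_surj y : exists e, th e = y.
  have [a ->] := xP y; exists (Sub (a *: xi) (memE a)) => /=.
  by apply: same; rewrite -rP.
(* The images in N of the summands of E form a chain, so their sum is zero or lies in the image of
   one summand. *)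
have cover g : dec X g -> exists2 S : submodClosed N,
    (forall y, y \in S -> y = 0) \/ (exists c (p : {linear X c -> E}),
       injective p /\ {subset S <= subim (lcomp th p) subT}) &
    forall e, th (g e) \in S.
  elim=> [|c p q {}g pK _ [S Sx gS]].
    by exists sub0; [left=> y /in_sub0 | move=> e; apply/in_sub0; rewrite linear0].
  have [h|h] := uN (subim (lcomp th p) subT) S.
    exists S => // e; rewrite linearD rpredD //; apply: h.
    by apply: (mem_subim (lcomp th p)); exact: in_subT.
  exists (subim (lcomp th p) subT).
    by right; exists c, p; split=> //; exact: can_inj pK.
  move=> e; rewrite linearD rpredD //; last exact: h.
  by apply: (mem_subim (lcomp th p)); exact: in_subT.
have [S Sx thS] := cover _ (fg_dec hA hX fgE).
have allS y : y \in S by have [e <-] := th_surj y.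
have [[y0 y0n] _] := indN.
case: Sx => [S0|[c [p [pinj Sp]]]]; first by rewrite (S0 y0) // eqxx in y0n.
have [|d Ud isod] := tD _ (lcomp [the {linear E -> D} of val] p) (fgX c) (indX c).
  by apply: inj_comp => //; exact: val_inj.
have ecd := uniqX isod; subst d.
have [d [f fbij]] := repX fgN indN; exists d; last by exists f.
apply: (Ucl.2 _ _ (lcomp f (lcomp th p)) _ Ud) => y.
have [g fK gK] := fbij; have /Sp/in_subim[z _ ez] := allS (g y).
by exists z; rewrite -[RHS]gK ez.
Qed.

End Killed.

Let length_spec : exists l : 'I_m -> nat, forall c,
  ranked (@subT _ (X c)) (l c) /\
  forall b, ranked (@subT _ (X c)) b -> (l c <= b)%N.
Proof.
have h c : exists n, ranked (@subT _ (X c)) n /\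
    forall b, ranked (@subT _ (X c)) b -> (n <= b)%N.
  by have [n rn minn] := ex_min_nat (artin_fg_ranked hA (fgX c)); exists n.
by have [l lP] := choice h; exists l.
Qed.

(* [rk] orders the indecomposables by composition length. *)
Let rank_spec : exists rk : 'I_m -> nat,
  [/\ injective rk, forall t, (t < m)%N -> exists c, rk c = t,
      forall c, (rk c < m)%N,
      forall c d (f : {linear X d -> X c}), injective f ->
        (rk d < rk c)%N \/ (forall y, exists x, f x = y) &
      forall c d (f : {linear X c -> X d}), (forall y, exists x, f x = y) ->
        (rk d < rk c)%N \/ injective f].
Proof.
have [l lP] := length_spec.
pose le : rel 'I_m := fun c d => (l c <= l d)%N.
(* Positions in the sorted list break ties between equal lengths, yet still increase strictly with
   length. *)
pose s := sort le (enum 'I_m).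
have ms c : c \in s by rewrite mem_sort mem_enum.
have size_s : size s = m by rewrite size_sort size_enum_ord.
have lt c d : (l d < l c)%N -> (index d s < index c s)%N.
  move=> ldc; rewrite ltnNge; apply/negP => cd.
  have tr : transitive le by move=> x y z; exact: leq_trans.
  have rf : reflexive le by move=> x; exact: leqnn.
  have srt : sorted le s by apply: sort_sorted => x y; exact: leq_total.
  have := sorted_leq_index tr rf srt c d (ms c) (ms d) cd.
  by rewrite /le leqNgt ldc.
exists (index^~ s); split.
- by move=> c d e; rewrite -(nth_index c (ms c)) e nth_index.
- move=> t tm; exists (nth (Ordinal tm) s t).
  by rewrite index_uniq ?size_s // sort_uniq enum_uniq.
- by move=> c; rewrite -[X in (_ < X)%N]size_s index_mem.
- move=> c d f finj.
  have [fs|nfs] := pselect (forall y, exists x, f x = y); [by right | left].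
  have [|b lb rb] := ranked_strict_sub (lP c).1 finj.
    apply: contrapT => ny; apply: nfs => y; apply: contrapT => nx; apply: ny.
    by exists y => x; apply/eqP => e; apply: nx; exists x.
  by apply: lt; exact: leq_ltn_trans ((lP d).2 _ rb) lb.
- move=> c d f fs.
  have [f0|nf0] := pselect (forall x, f x = 0 -> x = 0).
    by right; exact: linear_inj.
  left; have [|b lb rb] := ranked_strict_quot (lP c).1 fs.
    apply: contrapT => nx; apply: nf0 => x fx; apply: contrapT => /eqP x0.
    by apply: nx; exists x.
  by apply: lt; exact: leq_ltn_trans ((lP d).2 _ rb) lb.
Qed.

Section Sandwich.
Variables (U U' : 'I_m -> Prop) (c0 : 'I_m).
Hypotheses (Ucl : subquotient_closed U) (Ucl' : subquotient_closed U').
Hypothesis UU' : forall c, U c -> U' c \/ c = c0.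
Hypothesis endo_inj : forall f : {linear X c0 -> X c0},
  injective f -> forall y, exists x, f x = y.
Hypothesis endo_surj : forall f : {linear X c0 -> X c0},
  (forall y, exists x, f x = y) -> injective f.

(** The image of f = q y p is an indecomposable [X e] of U. If e is in U', then a kills it;
    otherwise e, c and d all equal c0 by closure of U', and f is an automorphism. *)
Let radical_map (y : B) c d (q : {linear M -> X c}) (p : {linear X d -> M}) a w :
    quotient_proj (annih_ideal X U') y \in
      @jacobson_radical (quotient_ring (annih_ideal X U')) ->
    U c -> U d -> annih X U' a -> a *: q (ap y (p w)) = 0.
Proof.
move=> yJ Uc Ud Ia; pose f : {linear X d -> X c} := lcomp q (lcomp (ap y) p).
rewrite -[q _]/(f w).
have [->|fw0] := eqVneq (f w) 0; first by rewrite scaler0.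
pose S := subim f subT.
have fS x : f x \in S by apply: mem_subim; exact: in_subT.
have fgS : finitely_generated (submodule S) by apply: fg_sub.
have indS : indecomposable (submodule S).
  by apply: uniserial_sub_indecomposable; [exact: nak | exists (f w)].
have [e [g /linear_inverse[g' gK g'K]]] := repX fgS indS.
pose i : {linear X e -> X c} := lcomp [the {linear submodule S -> X c} of val] g'.
pose r : {linear X d -> X e} := lcomp g (corestrict fS).
have iinj : injective i by apply: inj_comp; [exact: val_inj | exact: can_inj g'K].
have rsurj z : exists x, r x = z.
  have /in_subim[x _ ex] := valP (g' z); exists x.
  by rewrite -[RHS]g'K; congr (g _); apply: val_inj.
have fE x : f x = i (r x) by rewrite /= -[g _]/(g (corestrict fS x)) gK.
have Ue : U e by exact: Ucl.1 iinj Uc.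
have [U'e|ne] := pselect (U' e).
  by rewrite fE -linearZ_LR Ia // linear0.
have ee : e = c0 by case: (UU' Ue).
have ec : c = c0.
  by case: (UU' Uc) => // /(Ucl'.1 _ _ _ iinj).
have ed : d = c0.
  by case: (UU' Ud) => // /(Ucl'.2 _ _ _ rsurj).
clear Uc Ud Ue ne; subst e c d.
have fbij : bijective f.
  have isurj := endo_inj iinj.
  have rinj := endo_surj rsurj.
  apply: linear_bij => [x|z].
    by move=> fx; apply: rinj; apply: iinj; rewrite -fE fx !linear0.
  have [z' <-] := isurj z; have [x <-] := rsurj z'.
  by exists x; rewrite fE.
have [h fK hK] := linear_inverse fbij.
(* With h inverse to f, q (1 - y z) = 0. Since u inverts 1 - y z on the right modulo the ideal, q =
   - q ((1 - y z) u - 1), whose values are killed by a. *)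
pose z : B := lcomp p (lcomp h q).
have [u' eu'] := jacobson_quasiregular yJ (quotient_proj (annih_ideal X U') z).
have [u eu] := quotient_projS u'.
have tI : (1 - y * z) * u - 1 \in annih_ideal X U'.
  apply/quotient_projP; rewrite quotient_projM -eu.
  have -> : quotient_proj (annih_ideal X U') (1 - y * z) =
      1 - quotient_proj (annih_ideal X U') y * quotient_proj (annih_ideal X U') z.
    by rewrite -[quotient_proj _ y * _]quotient_projM /quotient_proj raddfB.
  exact: eu'.
have qz x : q (ap (1 - y * z) x) = 0.
  by rewrite apB linearB -[X in _ - X]/(f (h (q x))) hK subrr.
have qt x : q x = - q (ap ((1 - y * z) * u - 1) x).
  by rewrite apB linearB apM qz sub0r opprK.
rewrite -[f w]/(q (ap y (p w))) qt scalerN -linearZ_LR.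
by have /in_annih_ideal -> := tI; rewrite ?linear0 ?oppr0.
Qed.

(** The values of h2 and h1 lie in [socle X U M], whose summands [X c] are all in U by
    [killed_type]. Decomposing its identity on both sides of y reduces the claim to
    [radical_map]. *)
Lemma annih_sandwich : radical_sandwich_zero
  (quotient_ideal (annih_ideal X U') (annih_ideal X U)).
Proof.
apply: sandwich_zero => h1 y h2 h1I h2I yJ.
apply/in_annih_ideal => x a Ia.
pose K := socle X U M.
have fgK : finitely_generated (submodule K) by apply: fg_sub (fgM hX).
pose v : {linear submodule K -> M} := [the {linear _ -> _} of val].
have typeU c (p : {linear X c -> submodule K}) : injective p -> U c.
  move=> pinj; have [|d Ud iso] := killed_type Ucl (fgX c) (indX c).
    move=> b Ib w; apply: pinj; rewrite linear0 linearZZ; apply: val_inj.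
    by have /in_submod_of/(_ b Ib) := valP (p w).
  by rewrite (uniqX iso).
have dK := fg_dec hA hX fgK.
have inner g c (q : {linear M -> X c}) w : dec X g -> U c ->
    a *: q (ap y (v (g w))) = 0.
  move=> dg Uc; elim: dg => [|d p q' {}g pK _ IH].
    by rewrite !linear0 scaler0.
  rewrite !linearD scalerDr IH addr0.
  exact: (radical_map q (lcomp v p)) yJ Uc (typeU _ p (can_inj pK)) Ia.
have outer g : dec X g -> forall w,
    a *: v (g (corestrict (annih_ideal_socle h1I) (ap y (v w)))) = 0.
  move=> dg w; elim: dg => [|c p q {}g pK _ IH]; first by rewrite linear0 scaler0.
  rewrite linearD scalerDr IH addr0 -linearZ_LR -linearZ_LR.
  rewrite (inner _ c (lcomp q (corestrict (annih_ideal_socle h1I))) w dK) ?linear0 //.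
  exact: typeU (can_inj pK).
exact: (outer _ dK (corestrict (annih_ideal_socle h2I) x)).
Qed.

End Sandwich.

Lemma nakayama_strongly_quasi_hereditary :
  strongly_quasi_hereditary (auslander_algebra X).
Proof.
have [rk [rk_inj rk_onto rk_lt rk_sub rk_quot]] := rank_spec.
pose U t c := (rk c < t)%N : Prop.
have Ucl t : subquotient_closed (U t).
  split=> c d f fP Uc.
    have [lt|fs] := rk_sub c d f fP; first exact: ltn_trans lt Uc.
    have <- // : c = d; apply/esym/uniqX; exists f; apply: linear_bij => // x fx.
    by apply: fP; rewrite fx linear0.
  have [lt|finj] := rk_quot c d f fP; first exact: ltn_trans lt Uc.
  have <- // : c = d; apply/uniqX; exists f; apply: linear_bij => // x fx.
  by apply: finj; rewrite fx linear0.
have einj c (f : {linear X c -> X c}) : injective f -> forall y, exists x, f x = y.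
  by move=> finj; case: (rk_sub c c f finj) => //; rewrite ltnn.
have esurj c (f : {linear X c -> X c}) : (forall y, exists x, f x = y) -> injective f.
  by move=> fs; case: (rk_quot c c f fs) => //; rewrite ltnn.
(* The index runs backwards: H 0 comes from all m indecomposables, H m from none. *)
pose H i : ideal B := annih_ideal X (U (m - i)%N).
have sub i : {subset H i.+1 <= H i}.
  move=> f /in_annih_ideal fI; apply/in_annih_ideal => x a Ia; apply: fI => c Uc.
  by apply: Ia; apply: leq_trans Uc _; rewrite leq_sub2l.
have chain : idempotent_chain m H.
  split.
  - move=> f; suff -> : f \in H 0%N by [].
    apply/in_annih_ideal => x a Ia.
    apply: functional_extensionality_dep => c.
    by apply: (Ia c); rewrite /U subn0 rk_lt.
  - move=> f; apply/idP/eqP => [/in_annih_ideal fI|->]; last exact: ideal0.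
    apply: ap_inj => x; rewrite -[LHS]scale1r; apply: fI => c.
    by rewrite /U subnn ltn0.
  - by move=> i _; exact: annih_idempotent.
  - move=> i im; split=> [|sub']; first exact: sub.
    have [|c ec] := rk_onto (m - i.+1)%N; first by rewrite -subn_gt0 subKn // ltnW.
    have mi : (m - i = (m - i.+1).+1)%N by rewrite subnSK.
    (* The idempotent of the indecomposable removed at this step lies in H i; if it were in H i.+1,
       [killed_type] would put c in the smaller set. *)
    pose e : B := lcomp (dinj X c) (dproj X c).
    have /sub'/in_annih_ideal eI : e \in H i.
      apply/in_annih_ideal => x a Ia; rewrite -[ap e x]/(dinj X c (dproj X c x)) -linearZ_LR.
      have -> : a *: dproj X c x = 0; last by rewrite linear0.
      by apply: Ia; rewrite /U mi ec.
    have [|d] := killed_type (Ucl (m - i.+1)%N) (fgX c) (indX c).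
      move=> a Ia y; have := eI (dinj X c y) a Ia.
      rewrite -[ap e _]/(dinj X c (dproj X c (dinj X c y))) dinjK => h.
      by rewrite -[a *: y](@dinjK _ _ X c) linearZ_LR h linear0.
    by rewrite /U => Ud /uniqX; move: Ud => /[swap] <-; rewrite ec ltnn.
have rP i : projective (right_module (H i)) by exact: annih_right_projective.
have lP i : projective (left_module (H i)) by exact: annih_left_projective.
have sand i : (i < m)%N -> radical_sandwich_zero (quotient_ideal (H i.+1) (H i)).
  move=> im.
  have [|c ec] := rk_onto (m - i.+1)%N; first by rewrite -subn_gt0 subKn // ltnW.
  have mi : (m - i = (m - i.+1).+1)%N by rewrite subnSK.
  apply: (annih_sandwich (c0 := c) (Ucl _) (Ucl _) _ (einj c) (esurj c)) => d.
  rewrite /U mi ltnS leq_eqVlt => /orP[/eqP|]; last by left.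
  by rewrite -ec => /rk_inj; right.
exists m, H; split; split=> // i im.
- apply: quotient_heredity (rP i) (sand i im) => //; exact: annih_idempotent.
- by split; [exact: rP | exact: sand].
- by split; [exact: lP | exact: sand].
Qed.

End NakayamaSufficient.

Theorem theorem1p4 (A : pzRingType) (hA : artin_algebra A)
    (hfin : representation_finite A)
    (m : nat) (X : 'I_m -> rmodType A)
    (hX : indecomposable_representatives X) :
  strongly_quasi_hereditary (auslander_algebra X) <-> nakayama A.
Proof.
split; first exact: strongly_quasi_hereditary_nakayama.
exact: nakayama_strongly_quasi_hereditary.
Qed.
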